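(* There exists $\Delta_0$ such that for all $\Delta\ge\Delta_0$ the following holds. Let $G$ be a graph of maximum degree at most $\Delta$ with correspondence-assignment $(L,M)$. For each $v\in V(G)$ let \[ f(v)=72\cdot\min\left\{\sqrt{\frac{\ln(\omega(v))}{\ln(\deg(v))}},\ \frac{\omega(v)\ln(\ln(\deg(v)))}{\ln(\deg(v))},\ \frac{\log_2(\chi(v)+1)}{\ln(\deg(v))}\right\}. \] If for each $v\in V(G)$ we have $|L(v)|\ge \deg(v)\cdot f(v)$ and $\deg(v)\ge \ln^2(\Delta)$, then $G$ is $(L,M)$-colorable.
   Context: For a vertex $v$: $\deg(v)$ is its degree, $\omega(v)$ is the size of a largest clique containing $v$, and $\chi(v)$ is the chromatic number of the subgraph induced by the neighborhood of $v$. A correspondence-assignment $(L,M)$ for $G$ consists of a set $L(v)$ of colors for each vertex $v$, and for each edge $e=uv$ a matching $M_e$ between $\{u\}\times L(u)$ and $\{v\}\times L(v)$. An $(L,M)$-coloring is a map $\varphi$ with $\varphi(u)\in L(u)$ for all $u$ such that for every edge $e=uv$, $(u,\varphi(u))(v,\varphi(v))\notin M_e$. $G$ is $(L,M)$-colorable if such a coloring exists. *)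

(* Defs.v *)
From mathcomp Require Import all_boot all_order all_algebra.
From mathcomp Require Import finmap reals exp.

Set Implicit Arguments.
Unset Strict Implicit.
Unset Printing Implicit Defensive.

Import Order.TTheory GRing.Theory Num.Theory.

Local Open Scope ring_scope.

Record sgraph := SGraph {
  vertex :> finType;
  edge : rel vertex;
  edge_sym : symmetric edge;
  edge_irr : irreflexive edge
}.

Section Graph.
Variable G : sgraph.

Definition nbhd (v : G) : {set G} := [set w | edge v w].

Definition deg (v : G) : nat := #|nbhd v|.

Definition max_deg : nat := (\max_(v : G) deg v)%N.

Definition clique (K : {set G}) : bool :=
  [forall x in K, forall y in K, (x != y) ==> edge x y].

Definition omega (v : G) : nat :=
  (\max_(K : {set G} | clique K && (v \in K)) #|K|)%N.

Definition k_colorable (k : nat) : bool :=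
  [exists c : {ffun G -> 'I_k}, forall x, forall y, edge x y ==> (c x != c y)].

Lemma ex_k_colorable : exists k, k_colorable k.
Proof.
exists #|G|; apply/existsP; exists [ffun x => enum_rank x].
apply/forallP=> x; apply/forallP=> y; apply/implyP=> exy.
rewrite !ffunE (inj_eq enum_rank_inj).
by apply: contraTneq exy => ->; rewrite edge_irr.
Qed.

Definition chromatic_number : nat := ex_minn ex_k_colorable.

Variable S : {set G}.

Definition induced_edge : rel {x : G | x \in S} :=
  fun x y => edge (val x) (val y).

Lemma induced_edge_sym : symmetric induced_edge.
Proof. by move=> x y; apply: edge_sym. Qed.

Lemma induced_edge_irr : irreflexive induced_edge.
Proof. by move=> x; apply: edge_irr. Qed.

Definition induced : sgraph := SGraph induced_edge_sym induced_edge_irr.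

End Graph.

Definition chi (G : sgraph) (v : G) : nat := chromatic_number (induced (nbhd v)).

(* [corr LM u v a b] stands for "(u, a)(v, b) \in M_e" where e = uv; [corr_sym]
   says that this depends only on the unoriented edge e. Together with
   [corr_sym], [corr_matching] says that every (u, a) is in at most one pair
   of M_e, at either end of e. Values of [corr] outside edges of G are
   irrelevant. *)
Record corr_assignment (G : sgraph) (C : choiceType) := CorrAssignment {
  colors : G -> {fset C};
  corr : G -> G -> rel C;
  corr_sym : forall u v a b, edge u v -> corr u v a b = corr v u b a;
  corr_sub : forall u v a b, edge u v -> corr u v a b ->
    a \in colors u /\ b \in colors v;
  corr_matching : forall u v a b b', edge u v ->
    corr u v a b -> corr u v a b' -> b = b'
}.

Definition corr_coloring (G : sgraph) (C : choiceType)
    (LM : corr_assignment G C) (phi : G -> C) : Prop :=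
  (forall u, phi u \in colors LM u) /\
  (forall u v, edge u v -> ~~ corr LM u v (phi u) (phi v)).

Definition corr_colorable (G : sgraph) (C : choiceType)
    (LM : corr_assignment G C) : Prop :=
  exists phi : G -> C, corr_coloring LM phi.

Definition log2 (R : realType) (x : R) : R := ln x / ln 2.

(* The library's junk values ([ln x = 0] for [x <= 0], [x / 0 = 0], and
   [Num.sqrt x = 0] for [x < 0]) only matter when deg v <= 1. *)
Definition local_ratio (R : realType) (G : sgraph) (v : G) : R :=
  let d : R := (deg v)%:R in
  let w : R := (omega v)%:R in
  let c : R := (chi v)%:R in
  72 * Num.min (Num.sqrt (ln w / ln d))
        (Num.min (w * ln (ln d) / ln d)
                 (log2 (c + 1) / ln d)).

(* Main.v *)
(** Take a uniformly random proper partial coloring. Fix a vertex v of degree d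
    and condition on the coloring outside N(v). For a color c of v, the
    neighbors that block c form, given all the other color classes, a uniform
    independent set of a subgraph of G[N(v)]. Either this subgraph has few
    independent sets, and c survives with probability at least d^(-1/7) or so,
    or most of its independent sets have size at least 3 d / |L(v)|. The
    blocking sets are disjoint, so the second alternative cannot dominate and
    many colors survive with overwhelming probability. That one of the two
    alternatives holds comes from counting: Ramsey's theorem and averaging for
    the two bounds in terms of omega, a largest color class for the bound in
    terms of chi. It is also overwhelmingly likely that few neighbor-color pairs
    can still be added to the coloring, since otherwise adding them one by one
    would produce too many colorings. The local lemma makes both events hold at
    every vertex.

    It remains to color the uncolored vertices. Degrees may differ widely, so
    this is done in levels in which degrees differ at most quadratically, from
    high to low degrees. Inside a level, a counting argument in the style of
    Rosenfeld gives a proper coloring that takes only few colors away from each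
    vertex of a lower level. *)

Require Import Defs.
From mathcomp Require Import all_boot all_order all_algebra.
From mathcomp Require Import finmap reals exp.
From mathcomp Require Import lra ring zify.

Set Implicit Arguments.
Unset Strict Implicit.
Unset Printing Implicit Defensive.

Import Order.TTheory GRing.Theory Num.Theory.

Local Open Scope ring_scope.

(** * The local lemma *)

(** The usual finish, one more local lemma on the remaining lists, needs the conflict degree of a
    vertex to be small against the list lengths of its neighbors. Here degrees range from ln^2 Delta
    to Delta, and a neighbor of much smaller degree has a much shorter list. This forces the descent
    in levels, in which every level must also protect the lists below it.

    The bound deg v >= ln^2 Delta matters because the failure probability 2^(-m) at each vertex has
    to beat Delta^3. Then m = O(log Delta) is O(sqrt(deg v)), and the conflict degree, about m deg v
    divided by the list length, stays well below the list length.

    The constant 72 is 3 * 24. The 3 makes a large independent set three times as big as an average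
    blocking set can be. The 24 turns each term of the minimum into an inequality x^k <= deg v, with
    x one of omega, 2(r + 1), chi + 1 and k large enough for the counting of independent sets.

    Probabilities are ratios of cardinalities and parameters are powers of an integer root of deg v,
    so logarithms occur only in deriving these inequalities. *)

Lemma leq_card_bigcup (T I : finType) (P : pred I) (F : I -> {set T}) :
  (#|\bigcup_(i | P i) F i| <= \sum_(i | P i) #|F i|)%N.
Proof.
elim/big_rec2: _ => [|i n A _ leAn]; first by rewrite cards0.
by apply: leq_trans (leq_card_setU _ _) _; rewrite leq_add2l.
Qed.

Section LocalLemma.
Variables (O X : finType) (W : {set O}) (A : X -> {set O}).
Variables (dep : X -> {set X}) (p : X -> rat).

Definition avoiding (Y : {set X}) : {set O} :=
  [set o in W | [forall y in Y, o \notin A y]].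

Hypothesis W_neq0 : W != set0.
Hypothesis p_ge0 : forall x, 0 <= p x.
Hypothesis dep_refl : forall x, x \in dep x.
Hypothesis dep_sum : forall x, \sum_(y in dep x) p y <= 1 / 4.
Hypothesis cond_prob : forall x (Y : {set X}), [disjoint Y & dep x] ->
  (#|avoiding Y :&: A x|%:R <= p x * #|avoiding Y|%:R :> rat).

Lemma avoiding_sub (Y Z : {set X}) : Y \subset Z -> avoiding Z \subset avoiding Y.
Proof.
move=> /subsetP YZ; apply/subsetP => o; rewrite !inE => /andP[-> /forall_inP h] /=.
by apply/forall_inP => y /YZ; apply: h.
Qed.

(** Without the events of [dep x], [cond_prob] applies. By induction those events together remove at
    most half of [avoiding Y2], since their [p] sum to at most 1/4; restoring them costs a factor
    2. *)
Lemma local_lemma_step (Y : {set X}) (x : X) : x \notin Y ->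
  (#|avoiding Y :&: A x|%:R <= 2 * p x * #|avoiding Y|%:R :> rat).
Proof.
have [n] := ubnP #|Y|; elim: n Y x => // n IHn Y x leYn xY.
pose Y2 := Y :\: dep x.
have sY2 : Y2 \subset Y by apply: subsetDl.
have h1 : (#|avoiding Y :&: A x|%:R <= p x * #|avoiding Y2|%:R :> rat).
  apply: le_trans (cond_prob _).
    by rewrite ler_nat; apply/subset_leq_card/setSI/avoiding_sub.
  by rewrite disjoints_subset; apply/subsetP => y; rewrite !inE => /andP[].
have [Y0|[z]] := set_0Vmem (Y :&: dep x).
  have -> : Y = Y2.
    by apply/eqP; rewrite eqEsubset sY2 andbT; apply/subsetP => y yY;
       rewrite !inE yY andbT; apply/negP => yd; have := in_set0 y; rewrite -Y0 !inE yY yd.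
  apply: le_trans (cond_prob _) _.
    by rewrite disjoints_subset; apply/subsetP => y; rewrite !inE => /andP[].
  by rewrite ler_wpM2r ?ler0n // ler_peMl // ?p_ge0 //; lra.
move=> zY; have ltY2 : (#|Y2| < n)%N.
  apply: leq_trans (_ : #|Y| <= n)%N; last by rewrite -ltnS.
  apply: proper_card; rewrite properE sY2; apply/subsetPn; exists z.
    by move: zY; rewrite inE => /andP[].
  by move: zY; rewrite !inE => /andP[_ ->].
have sub : avoiding Y2 \subset
    avoiding Y :|: \bigcup_(y in Y :&: dep x) (avoiding Y2 :&: A y).
  apply/subsetP => o oY2; rewrite in_setU.
  have [//|oY /=] := boolP (o \in avoiding Y).
  move: (oY); have:= oY2; rewrite !inE => /andP[oW /forall_inP h]; rewrite oW /=.
  case/forall_inPn => y yY; rewrite negbK => oy.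
  apply/bigcupP; exists y; last by rewrite inE oy oY2.
  by rewrite inE yY /=; apply: contraT => nd; have := h y; rewrite !inE nd yY oy; apply.
have h2 : (#|avoiding Y2|%:R <= #|avoiding Y|%:R +
     \sum_(y in Y :&: dep x) 2 * p y * #|avoiding Y2|%:R :> rat).
  apply: le_trans (_ : (#|avoiding Y| +
     \sum_(y in Y :&: dep x) #|avoiding Y2 :&: A y|)%:R <= _).
    rewrite ler_nat; apply: leq_trans (subset_leq_card sub) _.
    apply: leq_trans (leq_card_setU _ _) _; rewrite leq_add2l.
    by apply: leq_card_bigcup.
  rewrite natrD lerD2l natr_sum; apply: ler_sum => y yY; apply: IHn => //.
  by move: yY; rewrite !inE => /andP[_ ->].
have h3 : \sum_(y in Y :&: dep x) 2 * p y * #|avoiding Y2|%:R <= 1/2 * #|avoiding Y2|%:R.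
  rewrite -mulr_suml; apply: ler_wpM2r; first by rewrite ler0n.
  rewrite -mulr_sumr; have := dep_sum x; rewrite (bigID (fun y => y \in Y)) /=.
  under eq_bigl do rewrite andbC -in_setI.
  have : 0 <= \sum_(i in dep x | i \notin Y) p i by apply: sumr_ge0.
  lra.
apply: le_trans h1 _.
rewrite -mulrA mulrCA; apply: ler_wpM2l => //; lra.
Qed.

(** Avoid the events one at a time: each removes at most a fraction 2 p x <= 1/2 of the outcomes
    left. *)
Lemma local_lemma : exists2 o, o \in W & forall x, o \notin A x.
Proof.
suff h (Y : {set X}) : (0 < #|avoiding Y|)%N.
  have /card_gt0P[o] := h setT; rewrite inE => /andP[oW /forall_inP ho].
  by exists o => // x; apply: ho.
have [n] := ubnP #|Y|; elim: n Y => // n IHn Y leYn.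
have [->|[x xY]] := set_0Vmem Y.
  rewrite card_gt0; apply: contraNneq W_neq0 => /setP h; apply/eqP/setP => o.
  by have := h o; rewrite !inE; case: (o \in W) => //= /negbT/forall_inPn[y]; rewrite inE.
have := IHn (Y :\ x); rewrite (cardsD1 x) xY in leYn; move=> /(_ leYn) pos.
have /= := @local_lemma_step (Y :\ x) x; rewrite !inE eqxx => /(_ isT) h.
have -> : avoiding Y = avoiding (Y :\ x) :\: A x.
  apply/setP => o; rewrite !inE; case: (o \in W) => //=; last by rewrite andbF.
  apply/forall_inP/andP => [ho|[ox /forall_inP ho] y yY].
    by split; [apply: ho|apply/forall_inP => y; rewrite !inE => /andP[_]; apply: ho].
  by have [->//|yx] := eqVneq y x; apply: ho; rewrite !inE yx.
have px : p x <= 1/4.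
  apply: le_trans (dep_sum x); rewrite (bigD1 x) //= lerDl; exact: sumr_ge0.
have hc := cardsID (A x) (avoiding (Y :\ x)).
rewrite lt0n; apply/eqP => h0; rewrite h0 addn0 in hc; rewrite hc in h.
have pos' : 0 < #|avoiding (Y :\ x)|%:R :> rat by rewrite ltr0n.
nra.
Qed.
End LocalLemma.

(** * Conditioning on all but a few coordinates *)

Section Fibers.
Variables (V D : finType).

Definition agree_off (S : {set V}) (f g : {ffun V -> D}) : bool :=
  [forall x, (x \notin S) ==> (f x == g x)].

Lemma agree_offP (S : {set V}) (f g : {ffun V -> D}) :
  reflect (forall x, x \notin S -> f x = g x) (agree_off S f g).
Proof.
by apply: (iffP forallP) => h x; [move=> xS; have /implyP/(_ xS)/eqP := h x
  | apply/implyP => /h ->].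
Qed.

Lemma card_fibers (O K : finType) (r : O -> K) (B : {set O}) :
  #|B| = (\sum_k #|[set o in B | r o == k]|)%N.
Proof.
rewrite -sum1_card (partition_big r predT) //=; apply: eq_bigr => k _.
by rewrite -sum1_card; apply: eq_bigl => o; rewrite !inE.
Qed.

(** B is a union of whole classes of [agree_off S], so a bound valid in each class that meets W sums
    to a bound conditional on B. This supplies the conditional probabilities of the local lemma. *)
Lemma fiberwise_le (S : {set V}) (W A B : {set {ffun V -> D}}) (q : rat) :
  (forall f g, agree_off S f g -> (f \in B) = (g \in B)) ->
  (forall g, g \in W -> (#|[set f in W | agree_off S g f] :&: A|%:R <=
      q * #|[set f in W | agree_off S g f]|%:R :> rat)) ->
  (#|(W :&: B) :&: A|%:R <= q * #|W :&: B|%:R :> rat).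
Proof.
move=> Binv fib.
pose r (f : {ffun V -> D}) : {ffun V -> option D} :=
  [ffun x => if x \in S then None else Some (f x)].
have rP f g : (r f == r g) = agree_off S f g.
  apply/eqP/agree_offP => [/ffunP h x xS|h].
    by have := h x; rewrite !ffunE (negbTE xS) => -[].
  by apply/ffunP => x; rewrite !ffunE; case: ifPn => // /h ->.
have fibE k g : g \in W -> r g == k ->
    [set o in W :&: B :&: A | r o == k] =
      [set f in W | agree_off S g f] :&: A :&: (if g \in B then setT else set0) /\
    [set o in W :&: B | r o == k] =
      [set f in W | agree_off S g f] :&: (if g \in B then setT else set0).
  move=> gW /eqP <-; split; apply/setP => o; rewrite !inE eq_sym rP;
  by case: (boolP (agree_off S g o)) => [/Binv <-|_]; case: (g \in B);
     rewrite /= ?inE; case: (o \in W); case: (o \in A); rewrite ?andbF.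
rewrite (card_fibers r) [in leRHS](card_fibers r) !natr_sum mulr_sumr.
apply: ler_sum => k _.
have [h0|[g]] := set_0Vmem [set o in W :&: B | r o == k].
  rewrite h0 cards0 mulr0 lern0 cards_eq0 -subset0 -h0.
  by apply/subsetP => o; rewrite !inE => /andP[/andP[-> _] ->].
rewrite !inE => /andP[/andP[gW gB] gk].
by have [-> ->] := fibE k g gW gk; rewrite gB !setIT; apply: fib.
Qed.
End Fibers.

(** * Partial colorings *)

Definition indsets (V : finType) (X : {set V}) (e : rel V) : {set {set V}} :=
  [set S : {set V} | (S \subset X) && [forall x in S, forall y in S, ~~ e x y]].

Lemma indsetsP (V : finType) (X S : {set V}) (e : rel V) :
  reflect (S \subset X /\ (forall x y, x \in S -> y \in S -> ~~ e x y)) (S \in indsets X e).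
Proof.
rewrite inE; apply: (iffP andP) => -[-> h]; split => //.
  by move=> x y xS yS; move/forall_inP/(_ x xS)/forall_inP: h; apply.
by apply/forall_inP => x xS; apply/forall_inP => y yS; apply: h.
Qed.

Lemma card_le1 (T : finType) (A : {set T}) :
  (forall x y, x \in A -> y \in A -> x = y) -> (#|A| <= 1)%N.
Proof.
move=> h; have [->|[x xA]] := set_0Vmem A; first by rewrite cards0.
rewrite -(cards1 x); apply: subset_leq_card; apply/subsetP => y yA.
by rewrite inE (h y x).
Qed.

(* [cf u a v b] says that uv is an edge whose matching contains (u, a)(v, b). *)
Section PartialColorings.
Variables (G : sgraph) (C : finType) (L : G -> {set C}).
Variable cf : G -> C -> G -> C -> bool.
Hypothesis cf_edge : forall u a v b, cf u a v b -> edge u v.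
Hypothesis cf_sym : forall u a v b, cf u a v b = cf v b u a.
Hypothesis cf_inj : forall u a v b b', cf u a v b -> cf u a v b' -> b = b'.

Lemma cf_injl u a a' v b : cf u a v b -> cf u a' v b -> a = a'.
Proof. by rewrite ![cf u _ _ _]cf_sym; apply: cf_inj. Qed.

Definition avail (f : {ffun G -> option C}) (u : G) (a : C) : bool :=
  (a \in L u) && [forall w, if f w is Some b then ~~ cf u a w b else true].

Lemma availP (f : {ffun G -> option C}) u a :
  reflect (a \in L u /\ forall w b, f w = Some b -> ~~ cf u a w b)
  (avail f u a).
Proof.
apply: (iffP andP) => -[-> h]; split => //.
  by move=> w b fw; move/forallP/(_ w): h; rewrite fw.
by apply/forallP => w; case E: (f w) => [b|//]; apply: h.
Qed.

Definition partials : {set {ffun G -> option C}} :=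
  [set f : {ffun G -> option C} | [forall u, if f u is Some a then avail f u a else true]].

Lemma partialsP (f : {ffun G -> option C}) :
  reflect (forall u a, f u = Some a -> avail f u a) (f \in partials).
Proof.
rewrite inE; apply: (iffP forallP) => h u; first by move=> a fu; have := h u; rewrite fu.
by case E: (f u) => [a|//]; apply: h.
Qed.

Definition cls (v : G) (c : C) (f : {ffun G -> option C}) : {set G} :=
  [set u | if f u is Some a then cf v c u a else false].

Lemma clsP v c (f : {ffun G -> option C}) u :
  reflect (exists2 a, f u = Some a & cf v c u a) (u \in cls v c f).
Proof.
rewrite inE; case: (f u) => [a|]; last by constructor => -[].
by apply: (iffP idP) => [h|[_ [<-]]//]; exists a.
Qed.

Definition kept (v : G) (f : {ffun G -> option C}) : {set C} :=
  [set c in L v | cls v c f == set0].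

(** Keeping only colors matched into [L v] leaves at most |L v| pairs at each neighbor, which bounds
    the loss in [addable_upd]. *)
Definition addable (v : G) (f : {ffun G -> option C}) : {set G * C} :=
  [set x | [&& x.1 \in nbhd v, f x.1 == None, avail f x.1 x.2 &
               [exists c in L v, cf v c x.1 x.2]]].

Definition upd (f : {ffun G -> option C}) (u : G) (o : option C) : {ffun G -> option C} :=
  [ffun w => if w == u then o else f w].

Lemma upd_partial f u a : f \in partials -> f u = None -> avail f u a ->
  upd f u (Some a) \in partials.
Proof.
move=> /partialsP fP fu /availP[aL fr]; apply/partialsP => w b; rewrite ffunE.
have [-> [<-]|wu fw] := eqVneq w u.
  apply/availP; split=> // x d; rewrite ffunE; have [-> _|_] := eqVneq x u; last exact: fr.
  by apply/negP => /cf_edge; rewrite edge_irr.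
have /availP[bL h] := fP _ _ fw; apply/availP; split=> // x d; rewrite ffunE.
have [-> [<-]|_] := eqVneq x u; last exact: h.
by rewrite cf_sym; apply: fr fw.
Qed.

(** Giving a to u destroys only pairs at u, at most one for each color of v, and pairs in conflict
    with (u, a), at most one at each neighbor of v. *)
Lemma addable_upd v f u a : (u, a) \in addable v f ->
  (#|addable v f| <= #|addable v (upd f u (Some a))| + (#|L v| + deg v))%N.
Proof.
rewrite !inE /= => /and4P[uv /eqP fu fa _].
pose N1 := \bigcup_(c in L v) [set x : G * C | (x.1 == u) && cf v c x.1 x.2].
pose N2 := \bigcup_(w in nbhd v) [set x : G * C | (x.1 == w) && cf u a x.1 x.2].
have c1 : (#|N1| <= #|L v|)%N.
  rewrite -[leqRHS]sum1_card; apply: leq_trans (leq_card_bigcup _ _) _; apply: leq_sum => c _.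
  apply: card_le1 => -[x1 x2] [y1 y2]; rewrite !inE /= => /andP[/eqP-> h1] /andP[/eqP-> h2].
  by rewrite (cf_inj h1 h2).
have c2 : (#|N2| <= deg v)%N.
  rewrite /deg -[leqRHS]sum1_card; apply: leq_trans (leq_card_bigcup _ _) _; apply: leq_sum => c _.
  apply: card_le1 => -[x1 x2] [y1 y2]; rewrite !inE /= => /andP[/eqP-> h1] /andP[/eqP-> h2].
  by rewrite (cf_inj h1 h2).
apply: leq_trans (_ : #|addable v (upd f u (Some a)) :|: (N1 :|: N2)| <= _)%N; last first.
  apply: leq_trans (leq_card_setU _ _) _; rewrite leq_add2l.
  apply: leq_trans (leq_card_setU _ _) _; exact: leq_add.
apply/subset_leq_card/subsetP => -[w b]; rewrite in_setU in_setU.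
rewrite [_ \in addable v f]inE /= => /and4P[wv /eqP fw fb /existsP[c /andP[cL cb]]].
have [wu|wu] := eqVneq w u.
  apply/orP; right; apply/orP; left; apply/bigcupP; exists c => //.
  by rewrite inE /= wu eqxx -wu.
have [h|h] := boolP (cf u a w b).
  apply/orP; right; apply/orP; right; apply/bigcupP; exists w => //.
  by rewrite inE /= eqxx.
apply/orP; left; rewrite inE /= wv ffunE (negbTE wu) fw eqxx /=; apply/andP; split; last first.
  by apply/existsP; exists c; rewrite cL.
move/availP: fb => [bL hb]; apply/availP; split => // x d; rewrite ffunE.
have [-> [<-]|_] := eqVneq x u; last exact: hb.
by rewrite cf_sym.
Qed.

Definition local_partials (v : G) (g : {ffun G -> option C}) : {set {ffun G -> option C}} :=
  [set f in partials | agree_off (nbhd v) g f].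

Lemma local_partialsP v g f :
  reflect (f \in partials /\ agree_off (nbhd v) g f) (f \in local_partials v g).
Proof. rewrite [f \in local_partials v g]inE; exact: andP. Qed.

(* Adding one pair (u, a) maps colorings with many addable pairs to colorings
   with nearly as many; each image arises in at most [deg v] ways, one for each
   candidate u, so every such step at least doubles the number of colorings. *)
Lemma many_addable_rare v g (m : nat) (B : {set {ffun G -> option C}}) :
  (0 < deg v)%N -> B \subset local_partials v g ->
  (forall f, f \in B -> m * (#|L v| + deg v) + 2 * deg v <= #|addable v f|)%N ->
  (2 ^ m * #|B| <= #|local_partials v g|)%N.
Proof.
move=> dpos; elim: m B => [|m IHm] B BF h.
  by rewrite mul1n; apply: subset_leq_card.
pose P := [set x : {ffun G -> option C} * (G * C) | (x.1 \in B) && (x.2 \in addable v x.1)].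
pose ph (x : {ffun G -> option C} * (G * C)) := (upd x.1 x.2.1 (Some x.2.2), x.2.1).
pose B' := [set (ph x).1 | x in P].
have B'F : B' \subset local_partials v g.
  apply/subsetP => _ /imsetP[[f [u a]] + ->]; rewrite inE /= => /andP[/(subsetP BF)].
  rewrite !inE /= => /andP[fW /agree_offP ag] /and4P[uv /eqP fu fa _].
  apply/andP; split; first by have := upd_partial _ fu fa; rewrite !inE; apply.
  apply/agree_offP => w wv; rewrite ffunE ag //; case: eqVneq => // wu.
  by rewrite wu inE uv in wv.
have hB' f : f \in B' -> (m * (#|L v| + deg v) + 2 * deg v <= #|addable v f|)%N.
  case/imsetP => -[f' [u a]] + ->; rewrite inE /= => /andP[/h + fa].
  rewrite mulSn => le1; have := leq_trans le1 (addable_upd fa); rewrite /ph /=; lia.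
have cP : (#|B| * (2 * deg v) <= #|P|)%N.
  rewrite -sum_nat_const -[#|P|]sum1_card (partition_big fst [in B]) /=; last first.
    by move=> x; rewrite inE => /andP[].
  apply: leq_sum => f fB; rewrite sum1_card.
  apply: leq_trans (_ : #|[set (f, x) | x in addable v f]| <= _)%N.
    rewrite card_imset => [|x y [] //]; exact: leq_trans (leq_addl _ _) (h f fB).
  apply: subset_leq_card; apply/subsetP => _ /imsetP[x xa ->].
  by rewrite [_ \in _]/= unfold_in /= inE /= fB xa eqxx.
have cP2 : (#|P| <= #|B'| * deg v)%N.
  rewrite -cardsX -(card_in_imset (f := ph) (D := P)).
    apply/subset_leq_card/subsetP => _ /imsetP[x xP ->]; rewrite inE; apply/andP; split.
      by apply/imsetP; exists x.
    by move: xP; rewrite /ph /= !inE => /andP[_ /and4P[]].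
  move=> [f [u a]] [f' [u' a']]; rewrite !inE /=.
  move=> /andP[_ /and4P[_ /eqP fu _ _]] /andP[_ /and4P[_ /eqP fu' _ _]].
  rewrite /ph /= => -[/ffunP E uu]; move: E; rewrite -uu in fu' * => E.
  have := E u; rewrite !ffunE eqxx => -[->]; congr (_, _); apply/ffunP => w.
  have := E w; rewrite !ffunE; case: eqVneq => // -> _; by rewrite fu fu'.
apply: leq_trans (IHm _ B'F hB'); rewrite expnS -mulnA mulnCA leq_mul2l mulnC.
by rewrite -(leq_pmul2r dpos) -mulnA; apply/orP; right; apply: leq_trans cP cP2.
Qed.

Section ClassWeights.
Variables (v : G) (c : C) (g : {ffun G -> option C}).

(** [erase] and [fill] separate a coloring into its other color classes and the vertex set of the
    class of c. The set determines the class, since at most one color of u is matched to c at v. *)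
Definition erase (f : {ffun G -> option C}) : {ffun G -> option C} :=
  [ffun u => if u \in cls v c f then None else f u].

Definition fill (h : {ffun G -> option C}) (S : {set G}) : {ffun G -> option C} :=
  [ffun u => if u \in S then [pick a | cf v c u a] else h u].

Definition open_nbrs (h : {ffun G -> option C}) : {set G} :=
  [set u | (h u == None) && [exists a, cf v c u a && avail h u a]].

Definition class_edge (u u' : G) : bool :=
  [exists a, exists a', [&& cf v c u a, cf v c u' a' & cf u a u' a']].

Lemma class_edgeP u u' :
  reflect (exists a a', [/\ cf v c u a, cf v c u' a' & cf u a u' a']) (class_edge u u').
Proof.
apply: (iffP existsP) => [[a /existsP[a' /and3P[]]]|[a [a' [h1 h2 h3]]]].
  by exists a, a'.
by exists a; apply/existsP; exists a'; apply/and3P.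
Qed.

Lemma pick_cf u a : cf v c u a -> [pick a | cf v c u a] = Some a.
Proof.
move=> h; case: pickP => [b hb|/(_ a)]; last by rewrite h.
by rewrite (cf_inj hb h).
Qed.

Lemma fill_cls f : fill (erase f) (cls v c f) = f.
Proof.
apply/ffunP => u; rewrite !ffunE; case: ifP => [/clsP[a -> h]|uN].
  exact: pick_cf.
by rewrite uN.
Qed.

(* Given the other color classes, the class of c is an arbitrary independent
   set of the graph [class_edge] on [open_nbrs]. *)
Lemma fill_fiber (h : {ffun G -> option C}) (S : {set G}) :
  h \in local_partials v g -> cls v c h = set0 ->
  ((fill h S \in local_partials v g) && (erase (fill h S) == h)) &&
     (cls v c (fill h S) == S)
  = (S \in indsets (open_nbrs h) class_edge).
Proof.
move=> hF h0; move: (hF); rewrite inE => /andP[hW /agree_offP hg].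
have hW' := partialsP _ hW.
apply/idP/idP.
  move=> /andP[/andP[fF /eqP Eh] /eqP ES].
  set f := fill h S in fF Eh ES.
  move: fF; rewrite inE => /andP[fW /agree_offP fg].
  have fW' := partialsP _ fW.
  apply/indsetsP; split.
    apply/subsetP => u; rewrite -ES => uS.
    have /clsP[a fu cu] := uS; rewrite inE -{1}Eh ffunE uS eqxx /=.
    apply/existsP; exists a; rewrite cu /=; have /availP[aL nb] := fW' _ _ fu.
    apply/availP; split => // w b; rewrite -Eh ffunE; case: ifP => // _; exact: nb.
  move=> u u'; rewrite -ES => /clsP[a fu cu] /clsP[a' fu' cu'].
  apply/class_edgeP => -[b [b' [h1 h2]]].
  rewrite -(cf_inj cu h1) -(cf_inj cu' h2); apply/negP.
  by have /availP[_ nb] := fW' _ _ fu; apply: nb.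
move=> /indsetsP[/subsetP SX Sind].
have fS u : u \in S -> exists a, [/\ fill h S u = Some a, cf v c u a, avail h u a & h u = None].
  move=> uS; have := SX u uS; rewrite inE => /andP[/eqP hu /existsP[a /andP[cu fu]]].
  by exists a; split => //; rewrite ffunE uS (pick_cf cu).
have fN u : u \notin S -> fill h S u = h u by move=> uS; rewrite ffunE (negbTE uS).
have clsS : cls v c (fill h S) = S.
  apply/setP => u; apply/clsP/idP => [[a + cu]|uS]; last first.
    by have [a [fu cu _ _]] := fS u uS; exists a.
  have [//|uS] := boolP (u \in S); rewrite fN // => hu.
  have : u \in cls v c h by apply/clsP; exists a.
  by rewrite h0 inE.
rewrite clsS eqxx andbT; apply/andP; split; last first.
  apply/eqP/ffunP => u; rewrite ffunE clsS; case: (boolP (u \in S)) => uS.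
    by have [a [_ _ _ ->]] := fS u uS.
  by rewrite fN.
rewrite inE; apply/andP; split; last first.
  apply/agree_offP => u uv; rewrite fN; first exact: hg.
  apply: contra uv => uS; have [a [_ cu _ _]] := fS u uS; rewrite inE.
  exact: cf_edge cu.
apply/partialsP => u a; have [uS|uS] := boolP (u \in S).
  have [b [-> cu /availP[bL nb] _]] := fS u uS => -[<-].
  apply/availP; split => // w d; have [wS|wS] := boolP (w \in S); last by rewrite fN //; apply: nb.
  have [x [-> cw _ _]] := fS w wS => -[<-].
  apply/negP => bad; have /class_edgeP := Sind u w uS wS; apply.
  by exists b, x.
rewrite fN // => /[dup] hu /hW'/availP[aL nb]; apply/availP; split => // w d.
have [wS|wS] := boolP (w \in S); last by rewrite fN //; apply: nb.
have [x [-> cw /availP[_ nb'] _]] := fS w wS => -[<-].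
by rewrite cf_sym; apply: nb' hu.
Qed.

Lemma sum_fiber (w : nat -> rat) (h : {ffun G -> option C}) :
  h \in local_partials v g -> cls v c h = set0 ->
  \sum_(f in local_partials v g | erase f == h) w #|cls v c f| =
  \sum_(S in indsets (open_nbrs h) class_edge) w #|S|.
Proof.
move=> hF h0; rewrite (reindex_onto (fill h) (cls v c)) /=.
  apply: eq_big => [S|S]; first exact: fill_fiber.
  by move=> /andP[_ /eqP ->].
by move=> f /andP[_ /eqP <-]; apply: fill_cls.
Qed.

Lemma erase_local f : f \in local_partials v g -> erase f \in local_partials v g.
Proof.
case/local_partialsP => fW /agree_offP fg.
have fW' := partialsP _ fW.
apply/local_partialsP; split.
  apply/partialsP => u a; rewrite ffunE; case: ifP => // _ /fW'/availP[aL nb].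
  apply/availP; split => // w b; rewrite ffunE; case: ifP => // _; exact: nb.
apply/agree_offP => u uv; rewrite ffunE -fg //; case: ifP => // /clsP[a _ /cf_edge].
by move: uv; rewrite inE => /negP.
Qed.

Lemma cls_erase f : cls v c (erase f) = set0.
Proof.
apply/setP => u; rewrite in_set0; apply/negbTE/clsP => -[a].
by rewrite ffunE; case: ifPn => // /clsP nu fu cu; apply: nu; exists a.
Qed.

Lemma cls_erase_neq c' f : c' != c -> cls v c' (erase f) = cls v c' f.
Proof.
move=> cc'; apply/setP => u; apply/clsP/clsP => -[a].
  by rewrite ffunE; case: ifP => // _ fu cu; exists a.
move=> fu cu; exists a => //; rewrite ffunE; case: ifP => // /clsP[b fb cb].
by case/eqP: cc'; move: fb cb; rewrite fu => -[<-]; apply: cf_injl cu.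
Qed.
End ClassWeights.

(** Induction on A. On a fiber of [erase v c] all weights except that of c are constant, and the
    class of c is a uniform independent set, so its average weight is at most q. No independence
    between colors is claimed. *)
Lemma class_product_le v (g : {ffun G -> option C}) (w : nat -> rat) (q : rat) (A : {set C}) :
  (forall n, 0 <= w n) -> 0 <= q ->
  (forall (X : {set G}) (e : rel G), X \subset nbhd v -> symmetric e -> subrel e (@edge G) ->
    \sum_(S in indsets X e) w #|S| <= q * #|indsets X e|%:R) ->
  \sum_(f in local_partials v g) \prod_(c in A) w #|cls v c f|
    <= q ^+ #|A| * #|local_partials v g|%:R.
Proof.
move=> w_ge0 q_ge0 occ; have [n] := ubnP #|A|; elim: n A => // n IHn A leA.
have [->|[c cA]] := set_0Vmem A.
  rewrite cards0 expr0 mul1r -sum1_card natr_sum; apply: ler_sum => f _.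
  by rewrite big_set0.
rewrite (cardsD1 c) cA exprS -mulrA.
apply: le_trans (_ : q * \sum_(f in local_partials v g)
    \prod_(c' in A :\ c) w #|cls v c' f| <= _); last first.
  by apply: ler_wpM2l => //; apply: IHn; move: leA; rewrite (cardsD1 c) cA.
pose H h := (h \in local_partials v g) && (cls v c h == set0).
have eH f : f \in local_partials v g -> H (erase v c f).
  by move=> fF; rewrite /H erase_local //= cls_erase.
rewrite (partition_big (erase v c) H) // [in leRHS](partition_big (erase v c) H) //.
rewrite mulr_sumr; apply: ler_sum => h /andP[hF /eqP h0].
have prodE f : erase v c f = h ->
    \prod_(c' in A :\ c) w #|cls v c' f| = \prod_(c' in A :\ c) w #|cls v c' h|.
  by move=> <-; apply: eq_bigr => c'; rewrite !inE => /andP[cc' _]; rewrite cls_erase_neq.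
under eq_bigr => f /andP[_ /eqP Ef] do rewrite (big_setD1 c) //= prodE //.
under [in leRHS]eq_bigr => f /andP[_ /eqP Ef] do rewrite prodE //.
rewrite -mulr_suml sum_fiber // sumr_const -mulr_natl mulrA.
apply: ler_wpM2r; first exact: prodr_ge0.
apply: le_trans (occ _ _ _ _ _) _.
- apply/subsetP => u; rewrite !inE => /andP[_ /existsP[a /andP[/cf_edge]]] //.
- move=> x y; apply/class_edgeP/class_edgeP => -[a [b [h1 h2 h3]]];
  by exists b, a; split; rewrite // cf_sym.
- by move=> x y /class_edgeP[a [b [_ _ /cf_edge]]].
apply: ler_wpM2l => //.
(* Weight 1 counts the fiber: it has as many colorings as there are independent sets. *)
have := @sum_fiber v c g (fun=> 1) h hF h0; rewrite !sumr_const => /eqP.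
rewrite eqr_nat => /eqP Ec; rewrite ler_nat -Ec; apply: eq_leq.
exact: eq_card.
Qed.
End PartialColorings.

(** * A partial coloring with long remaining lists *)

(* The dichotomy of the header, with T the threshold for "few" and K the size of
   "large". *)
Definition occupancy (G : sgraph) (v : G) (T K : nat) : Prop :=
  forall (X : {set G}) (e : rel G),
    X \subset nbhd v -> symmetric e -> subrel e (@edge G) ->
    (#|indsets X e| <= T)%N \/
    (#|indsets X e| <= 2 * #|[set S in indsets X e | (K <= #|S|)%N]|)%N.

(* The expected weight of a color class is at most 1 - 1/(2T) under either
   alternative of [occupancy]; rounding n / K down avoids K-th roots. *)
Definition class_weight (T K n : nat) : rat :=
  if n == 0%N then 1 / 2 else (1 - T%:R^-1) ^+ (n %/ K).

Lemma bernoulli (R : realFieldType) (x : R) n : -1 <= x -> 1 + n%:R * x <= (1 + x) ^+ n.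
Proof.
move=> x1; elim: n => [|n IHn]; first by rewrite mul0r addr0 expr0.
rewrite exprS -natr1.
have h : (1 + x) * (1 + n%:R * x) <= (1 + x) * (1 + x) ^+ n.
  by apply: ler_wpM2l => //; lra.
apply: le_trans h; have : 0 <= n%:R * (x * x) by rewrite mulr_ge0 ?ler0n // -expr2 sqr_ge0.
nra.
Qed.

Lemma expr_one_sub_inv (R : realFieldType) (N : nat) : (0 < N)%N ->
  (1 - N%:R^-1 : R) ^+ N <= 1 / 2.
Proof.
move=> N0; have N0' : 0 < N%:R :> R by rewrite ltr0n.
set y := (N%:R^-1 : R).
have y0 : 0 < y by rewrite invr_gt0.
have y1 : y <= 1 by rewrite invf_le1 // ler1n.
have h2 : 2 <= (1 + y) ^+ N.
  apply: le_trans (bernoulli _ _); last by lra.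
  by rewrite divff ?gt_eqF //; lra.
have h3 : (1 - y) ^+ N * (1 + y) ^+ N <= 1.
  by rewrite -exprMn; apply: exprn_ile1; nra.
have : 0 <= (1 - y) ^+ N by apply: exprn_ge0; lra.
nra.
Qed.

(** Compares the mean of the product of class weights with its value at a coloring with few kept
    colors. The list length k is used twice: 3 D <= k offsets the factor (1 - 1/T)^D, and the other
    condition gains m + 2 l halvings. *)
Lemma weight_numerics (R : realFieldType) (T k D l m : nat) :
  (2 <= T)%N -> (3 * D <= k)%N -> (4 * T * (3 * m + 6 * l) <= k)%N ->
  (1 - (2 * T)%:R^-1 : R) ^+ k <= (1 / 2) ^+ m * ((1 / 2) ^+ (2 * l) * (1 - T%:R^-1) ^+ D).
Proof.
move=> T2 Dk lk.
have T0 : 2 <= T%:R :> R by rewrite (ler_nat R 2).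
set x := ((2 * T)%:R^-1 : R).
have x0 : 0 < x by rewrite invr_gt0 ltr0n; lia.
have x4 : x <= 1 / 4.
  rewrite /x natrM invfM; have : (T%:R^-1 : R) <= 2^-1 by rewrite lef_pV2 ?posrE //; lra.
  by lra.
have ET : T%:R^-1 = 2 * x by rewrite /x natrM invfM mulrA divff ?mul1r // pnatr_eq0.
have Ex : (4 * T)%:R^-1 = x / 2.
  by rewrite /x !natrM !invfM; field; rewrite pnatr_eq0; lia.
rewrite ET.
rewrite -(@ler_pXn2r _ 3) ?nnegrE //; last 2 first.
- by apply: exprn_ge0; lra.
- by rewrite !mulr_ge0 ?exprn_ge0 //; lra.
rewrite -exprM mulnC exprM.
(* Cubing separates the two uses: (1 - x)^3 <= (1 - 2 x)(1 - x / 2) for 0 <= x <= 1/4, where 2 x =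
   1/T and x / 2 = 1/(4 T). *)
apply: le_trans (_ : ((1 - 2 * x) * (1 - x / 2)) ^+ k <= _).
  rewrite lerXn2r ?nnegrE //; first by apply: exprn_ge0; lra.
    by apply: mulr_ge0; lra.
  rewrite !exprS expr0; nra.
rewrite exprMn mulrA exprMn mulrC; apply: ler_pM.
- by apply: exprn_ge0; lra.
- by apply: exprn_ge0; lra.
- rewrite -exprD -exprM.
  apply: le_trans (_ : (1 - x / 2) ^+ (4 * T * (3 * m + 6 * l)) <= _).
    by apply: ler_wiXn2l => //; lra.
  rewrite exprM [X in _ ^+ X](_ : _ = ((m + 2 * l) * 3)%N); last by lia.
  rewrite lerXn2r ?nnegrE //.
  - by apply: exprn_ge0; lra.
  - lra.
  - by rewrite -Ex; apply: expr_one_sub_inv; lia.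
- by rewrite -exprM; apply: ler_wiXn2l; [lra|lra|lia].
Qed.

Section FirstPhase.
Variables (G : sgraph) (C : finType) (L : G -> {set C}).
Variable cf : G -> C -> G -> C -> bool.
Hypothesis cf_edge : forall u a v b, cf u a v b -> edge u v.
Hypothesis cf_sym : forall u a v b, cf u a v b = cf v b u a.
Hypothesis cf_inj : forall u a v b b', cf u a v b -> cf u a v b' -> b = b'.

(** In the first alternative the empty set has probability at least 1/T and weight 1/2; in the
    second, at least half of the sets have weight at most 1 - 1/T. *)
Lemma occupancy_weight (v : G) T K : (0 < K)%N -> (0 < T)%N -> occupancy v T K ->
  forall (X : {set G}) (e : rel G), X \subset nbhd v -> symmetric e -> subrel e (@edge G) ->
  \sum_(S in indsets X e) class_weight T K #|S| <= (1 - (2 * T)%:R^-1) * #|indsets X e|%:R.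
Proof.
move=> K0 T0 occ X e Xv sy sub; set I := indsets X e.
have T1 : 0 < (T%:R^-1 : rat) <= 1.
  by rewrite invr_gt0 ltr0n T0 /= invf_le1 ?ltr0n // ler1n.
have ET : ((2 * T)%:R^-1 : rat) = T%:R^-1 / 2 by rewrite natrM invfM mulrC.
have w1 n : class_weight T K n <= 1.
  rewrite /class_weight; case: ifP => _; first lra.
  by apply: exprn_ile1; lra.
have I0 : set0 \in I.
  by apply/indsetsP; split; [apply: sub0set|move=> x y; rewrite inE].
case: (occ X e Xv sy sub); rewrite -/I => hI.
  rewrite (big_setD1 set0) //= cards0 /class_weight eqxx -/(class_weight _ _).
  apply: le_trans (_ : 1 / 2 + \sum_(S in I :\ set0) 1 <= _).
    by rewrite lerD2l; apply: ler_sum => S _; apply: w1.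
  have EI : #|I|%:R = 1 + #|I :\ set0|%:R :> rat by rewrite (cardsD1 set0 I) I0 natrD.
  rewrite sumr_const ET EI.
  have : (#|I|%:R : rat) * T%:R^-1 <= 1 by rewrite ler_pdivrMr ?ltr0n // mul1r ler_nat.
  rewrite EI; lra.
rewrite ET.
pose big (S : {set G}) := (K <= #|S|)%N.
have E : #|I| = (#|[set S in I | big S]| + #|[set S in I | ~~ big S]|)%N.
  rewrite -(cardsID [set S | big S] I); congr (_ + _)%N; apply: eq_card => S; rewrite !inE //.
  by rewrite andbC.
apply: le_trans (_ : \sum_(S in I | big S) (1 - T%:R^-1) + \sum_(S in I | ~~ big S) 1 <= _).
  rewrite (bigID big) /=; apply: lerD; apply: ler_sum => S /andP[SI bS]; last exact: w1.
  rewrite /class_weight; case: eqP => [S0|_]; first by move: bS; rewrite /big S0; lia.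
  have : (0 < #|S| %/ K)%N by rewrite divn_gt0.
  case: (_ %/ _)%N => // n _; rewrite exprS ler_piMr //; first lra.
  by apply: exprn_ile1; lra.
rewrite !sumr_const.
have -> : #|(fun S => (S \in I) && big S)| = #|[set S in I | big S]|.
  by apply: eq_card => S; rewrite [RHS]inE.
have -> : #|(fun S => (S \in I) && ~~ big S)| = #|[set S in I | ~~ big S]|.
  by apply: eq_card => S; rewrite [RHS]inE.
rewrite E natrD -[_ *+ _]mulr_natr.
move: hI; rewrite E -(ler_nat rat) natrM natrD.
have : 0 <= #|[set S in I | big S]|%:R :> rat by [].
nra.
Qed.

(** A colored neighbor blocks at most one color of v. *)
Lemma sum_cls v (f : {ffun G -> option C}) : (\sum_(c in L v) #|cls cf v c f| <= deg v)%N.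
Proof.
apply: leq_trans (_ : \sum_(c in L v) \sum_(u in nbhd v | u \in cls cf v c f) 1 <= _)%N.
  apply: leq_sum => c _; rewrite sum1dep_card; apply/subset_leq_card/subsetP => u uc.
  rewrite in_set uc andbT; have /clsP[a _ /cf_edge] := uc; by rewrite inE.
rewrite (exchange_big_dep (mem (nbhd v))) //=; last by move=> i j _ /andP[].
rewrite (_ : deg v = \sum_(u in nbhd v) 1)%N; last by rewrite sum1_card.
apply: leq_sum => u _.
rewrite sum1dep_card; apply: card_le1 => c c'; rewrite !in_set.
move=> /andP[_ /andP[_ h]] /andP[_ /andP[_ h']].
move: h h'; case: (f u) => // a cu cu'.
by rewrite cf_sym in cu; rewrite cf_sym in cu'; apply: cf_inj cu cu'.
Qed.

(** Markov's inequality for the product of the class weights. With fewer than 2 l kept colors the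
    product is at least 2^(-2 l) (1 - 1/T)^(deg v / K), as the blocking classes have total size at
    most deg v, while its mean is at most (1 - 1/(2 T))^|L v|. *)
Lemma few_kept_rare v (g : {ffun G -> option C}) (T K l m : nat) :
  (2 <= T)%N -> (0 < K)%N -> occupancy v T K -> (3 * deg v <= #|L v| * K)%N ->
  (4 * T * (3 * m + 6 * l) <= #|L v|)%N ->
  (2 ^ m * #|[set f in local_partials L cf v g | (#|kept L cf v f| < 2 * l)%N]|
    <= #|local_partials L cf v g|)%N.
Proof.
move=> T2 K0 occ Kk lk.
set F := local_partials L cf v g; set B := [set f in F | _].
have T1 : 0 < (T%:R^-1 : rat) <= 1 / 2.
  rewrite invr_gt0 ltr0n (ltn_trans _ T2) //= div1r lef_pV2 ?posrE ?ltr0n //; last lia.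
  by rewrite (ler_nat _ 2).
have w0 n : 0 <= class_weight T K n.
  by rewrite /class_weight; case: ifP => _; [lra|apply: exprn_ge0; lra].
have ET : ((2 * T)%:R^-1 : rat) = T%:R^-1 / 2 by rewrite natrM invfM mulrC.
have main : \sum_(f in F) \prod_(c in L v) class_weight T K #|cls cf v c f| <=
    (1 - (2 * T)%:R^-1) ^+ #|L v| * #|F|%:R.
  apply: class_product_le => //; first by rewrite ET; lra.
  by apply: occupancy_weight => //; lia.
set D := (deg v %/ K)%N; set y := (1 / 2) ^+ (2 * l) * (1 - (T%:R^-1 : rat)) ^+ D.
have y0 : 0 < y by rewrite mulr_gt0 // exprn_gt0 //; lra.
have lowB f : f \in B -> y <= \prod_(c in L v) class_weight T K #|cls cf v c f|.
  rewrite inE => /andP[_ few].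
  rewrite (bigID (fun c => cls cf v c f == set0)) /=; apply: ler_pM.
  - by apply: exprn_ge0; lra.
  - by apply: exprn_ge0; lra.
  - under eq_bigr => c /andP[_ /eqP E0] do rewrite E0 cards0 /class_weight eqxx.
    rewrite prodr_const; apply: ler_wiXn2l; [lra|lra|].
    apply: leq_trans (ltnW few); apply: eq_leq; apply: eq_card => c.
    by rewrite [RHS]inE.
  apply: le_trans (_ : \prod_(c in L v | cls cf v c f != set0)
      (1 - T%:R^-1) ^+ (#|cls cf v c f| %/ K) <= _); last first.
    apply: ler_prod => c /andP[_ E0]; rewrite /class_weight cards_eq0 (negbTE E0) lexx andbT.
    by apply: exprn_ge0; lra.
  rewrite prodrXr; apply: ler_wiXn2l; [lra|lra|].
  apply: leq_trans (_ : (\sum_(c in L v) #|cls cf v c f| %/ K) <= _)%N.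
    by rewrite [leqRHS](bigID (fun c => cls cf v c f == set0)) /= leq_addl.
  rewrite leq_divRL // big_distrl /=; apply: leq_trans (sum_cls v f).
  by apply: leq_sum => c _; apply: leq_trunc_div.
have {}main : y * #|B|%:R <= (1 - (2 * T)%:R^-1) ^+ #|L v| * #|F|%:R.
  apply: le_trans main; rewrite mulr_natr -sumr_const.
  rewrite [leRHS](bigID (mem B)) /=.
  rewrite (_ : \sum_(f in F | f \in B) _ =
     \sum_(f in B) \prod_(c in L v) class_weight T K #|cls cf v c f|); last first.
    by apply: eq_bigl => f /=; rewrite andb_idl // inE => /andP[].
  apply: le_trans (_ : \sum_(f in B) \prod_(c in L v) class_weight T K #|cls cf v c f| <= _).
    exact: ler_sum.
  by rewrite lerDl; apply: sumr_ge0 => f _; apply: prodr_ge0.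
have num : (1 - (2 * T)%:R^-1) ^+ #|L v| <= (1 / 2) ^+ m * y.
  apply: weight_numerics => //.
  have : (3 * (D * K) <= #|L v| * K)%N.
    by apply: leq_trans Kk; rewrite leq_mul2l leq_trunc_div.
  by rewrite mulnA leq_pmul2r.
rewrite -(ler_nat rat) natrM natrX.
have h : y * #|B|%:R <= y * ((1 / 2) ^+ m * #|F|%:R).
  apply: le_trans main _; rewrite [leRHS]mulrCA mulrA mulrAC; rewrite mulrAC.
  by apply: ler_wpM2r => //; rewrite mulrC.
rewrite ler_pM2l // in h.
apply: le_trans (_ : 2 ^+ m * ((1 / 2) ^+ m * #|F|%:R) <= _).
  by apply: ler_wpM2l => //; apply: exprn_ge0.
by rewrite mulrA -exprMn mul1r divff // expr1n mul1r.
Qed.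

Definition bad_event (l z : nat) (v : G) : {set {ffun G -> option C}} :=
  [set f | (#|kept L cf v f| < 2 * l)%N || (z <= #|addable L cf v f|)%N].

(** Endpoints of walks of length 2 or 3 from v. The bad event of y reads the coloring at the
    neighbors of y and at their neighbors, so recoloring inside [nbhd v] can affect only such y. *)
Definition dependents (v : G) : {set G} :=
  \bigcup_(u in nbhd v) (nbhd u :|: \bigcup_(w in nbhd u) nbhd w).

Lemma card_dependents v D : (forall u : G, deg u <= D)%N ->
  (#|dependents v| <= D ^ 2 + D ^ 3)%N.
Proof.
move=> dD; apply: leq_trans (leq_card_bigcup _ _) _.
have bound u n (F : G -> nat) : (forall w, F w <= n)%N -> (\sum_(w in nbhd u) F w <= D * n)%N.
  move=> Fn; apply: leq_trans (_ : \sum_(w in nbhd u) n <= _)%N; first exact: leq_sum.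
  by rewrite sum_nat_const leq_mul2r dD orbT.
have -> : (D ^ 2 + D ^ 3 = D * (D + D * D))%N by rewrite mulnDr !expnS expn0; lia.
apply: (bound v _ (fun u => #|nbhd u :|: \bigcup_(w in nbhd u) nbhd w|)) => u.
apply: leq_trans (leq_card_setU _ _) _; apply: leq_add; first exact: dD.
apply: leq_trans (leq_card_bigcup _ _) _; exact: (bound u _ (fun w => #|nbhd w|)).
Qed.

Lemma bad_event_local l z v y (f g : {ffun G -> option C}) :
  y \notin dependents v -> agree_off (nbhd v) f g ->
  (f \in bad_event l z y) = (g \in bad_event l z y).
Proof.
move=> yv /agree_offP fg.
have n1 u : edge y u -> f u = g u.
  move=> yu; apply: fg; apply: contra yv => uv; apply/bigcupP; exists u => //.
  by rewrite !inE edge_sym yu.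
have n2 u w : edge y u -> edge u w -> f w = g w.
  move=> yu uw; apply: fg; apply: contra yv => wv; apply/bigcupP; exists w => //.
  rewrite inE; apply/orP; right; apply/bigcupP; exists u; rewrite inE edge_sym //.
have clsE c : cls cf y c f = cls cf y c g.
  apply/setP => u; apply/clsP/clsP => -[a + cu]; move: (cu) => /cf_edge/n1 E;
  by [rewrite E => fu; exists a | rewrite -E => fu; exists a].
have keptE : kept L cf y f = kept L cf y g.
  by apply/setP => c; rewrite !inE clsE.
have addE : addable L cf y f = addable L cf y g.
  apply/setP => -[u a]; rewrite !inE /=; case: (boolP (edge y u)) => //= yu.
  rewrite n1 //; suff -> : avail L cf f u a = avail L cf g u a by [].
  have E w b : cf u a w b -> f w = g w by move=> /cf_edge; apply: n2.
  apply/availP/availP => -[aL nb]; split=> // w b fw; apply/negP => /[dup] /E Ew;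
  by apply/negP/nb; rewrite ?Ew // -Ew.
by rewrite !inE keptE addE.
Qed.

(** The local lemma: given the coloring outside [nbhd v], each of the two failures at v has
    probability at most 2^(-m), and at most D^2 + D^3 events depend on [nbhd v]. *)
Lemma first_phase (D m : nat) (T K l : G -> nat) :
  (forall v : G, 0 < deg v <= D)%N ->
  (8 * (D ^ 2 + D ^ 3) <= 2 ^ m)%N ->
  (forall v, (2 <= T v)%N /\ (0 < K v)%N) ->
  (forall v, occupancy v (T v) (K v)) ->
  (forall v, 3 * deg v <= #|L v| * K v)%N ->
  (forall v, 4 * T v * (3 * m + 6 * l v) <= #|L v|)%N ->
  exists2 f, f \in partials L cf & forall v,
    (2 * l v <= #|kept L cf v f|)%N /\
    (#|addable L cf v f| < m * (#|L v| + deg v) + 2 * deg v)%N.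
Proof.
move=> degD Dm TK occ Kk lk.
pose z v := (m * (#|L v| + deg v) + 2 * deg v)%N.
pose A v := bad_event (l v) (z v) v.
have depv v : v \in dependents v.
  have /card_gt0P[u] : (0 < #|nbhd v|)%N by case/andP: (degD v).
  move=> uv; apply/bigcupP; exists u => //; rewrite !inE edge_sym.
  by move: uv; rewrite inE => ->.
have pos2 : 0 < (2 ^ m)%:R :> rat by rewrite ltr0n expn_gt0.
have [|_|//|v|v Y dY|f fW fA] := @local_lemma _ _ (partials L cf) A dependents
    (fun=> 2 / (2 ^ m)%:R).
- apply/set0Pn; exists [ffun=> None]; apply/partialsP => u a; by rewrite ffunE.
- exact: divr_ge0.
- rewrite sumr_const -[_ *+ #|_|]mulr_natl mulrA ler_pdivrMr //.
  have : (#|dependents v|%:R <= (D ^ 2 + D ^ 3)%:R :> rat).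
    by rewrite ler_nat; apply: card_dependents => u; case/andP: (degD u).
  move: Dm; rewrite -(ler_nat rat) natrM; lra.
- have EB : avoiding (partials L cf) A Y =
      partials L cf :&: [set f | [forall y in Y, f \notin A y]].
    by apply/setP => f; rewrite !inE.
  rewrite EB; apply: (fiberwise_le (S := nbhd v)) => [f g fg|g gW].
    rewrite !inE; apply/forall_inP/forall_inP => h y yY; have := h y yY; apply: contra;
    rewrite (bad_event_local _ _ _ fg) //; apply: contraTN yY => yd;
    by apply: contraTN yd => yY; move/disjointFr: dY => ->.
  set F := [set f in partials L cf | _].
  have B1 := few_kept_rare g (TK v).1 (TK v).2 (occ v) (Kk v) (lk v).
  pose B2 := [set f in F | (z v <= #|addable L cf v f|)%N].
  have := @many_addable_rare G C L cf cf_edge cf_sym cf_inj v g m B2.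
  rewrite (andP (degD v)).1 => /(_ isT) B2'.
  have {B2'} : (2 ^ m * #|B2| <= #|local_partials L cf v g|)%N.
    apply: B2' => [|f]; first by apply/subsetP => f; rewrite inE => /andP[].
    by rewrite inE => /andP[].
  move: B1; rewrite -/F -!(ler_nat rat) !natrM => b1 b2.
  have : (#|F :&: A v|%:R <= #|[set f in F | (#|kept L cf v f| < 2 * l v)%N]|%:R + #|B2|%:R :> rat).
    rewrite -natrD ler_nat; apply: leq_trans (leq_card_setU _ _).
    apply/subset_leq_card/subsetP => f.
    rewrite !in_setU [f \in B2]inE [f \in [set _ in _ | _]]inE.
    by rewrite in_setI [f \in A v]inE => /andP[-> /=].
  move=> le1; rewrite mulrAC ler_pdivlMr //; nra.
exists f => // v; have := fA v; rewrite inE negb_or -leqNgt -ltnNge => /andP[] //.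
Qed.
End FirstPhase.

(** * Coloring one degree level *)

(* [T] is the level being colored and [Low] the set of vertices of lower level;
   u in [Low] must lose fewer than [s u] colors. *)
Section LevelColoring.
Variables (G : sgraph) (C : finType).
Variable cf : G -> C -> G -> C -> bool.
Hypothesis cf_edge : forall u a v b, cf u a v b -> edge u v.
Hypothesis cf_sym : forall u a v b, cf u a v b = cf v b u a.
Hypothesis cf_inj : forall u a v b b', cf u a v b -> cf u a v b' -> b = b'.

Variables (Q : G -> {set C}) (T Low : {set G}) (s : G -> nat) (D : nat).

Definition hit (u w : G) (b : C) : bool := [exists c in Q u, cf u c w b].

Definition hits (u : G) (f : {ffun G -> option C}) : {set G} :=
  [set w | if f w is Some b then hit u w b else false].

Lemma hitsP u (f : {ffun G -> option C}) w :
  reflect (exists2 b, f w = Some b & hit u w b) (w \in hits u f).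
Proof.
rewrite inE; case: (f w) => [a|]; last by constructor => -[].
by apply: (iffP idP) => [h|[_ [<-]]//]; exists a.
Qed.

Lemma hit_edge u w b : hit u w b -> edge u w.
Proof. by case/existsP=> c /andP[_ /cf_edge]. Qed.

(** Locked to keep [inE] from unfolding membership; [level_coloringsP] is the interface. *)
Definition level_colorings (Y : {set G}) : {set {ffun G -> option C}} :=
  locked [set f : {ffun G -> option C} | [&&
     [forall v, if f v is Some a then (v \in Y) && (a \in Q v) else v \notin Y],
     [forall v, [forall w, if f v is Some a then
        (if f w is Some b then ~~ cf v a w b else true) else true]] &
     [forall u in Low, (#|hits u f| < s u)%N]]].

Lemma level_coloringsP (Y : {set G}) (f : {ffun G -> option C}) :
  reflect [/\ forall v, v \in Y -> exists2 a, f v = Some a & a \in Q v,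
              forall v, v \notin Y -> f v = None,
              forall v w a b, f v = Some a -> f w = Some b -> ~~ cf v a w b &
              forall u, u \in Low -> (#|hits u f| < s u)%N]
    (f \in level_colorings Y).
Proof.
rewrite /level_colorings -lock inE.
apply: (iffP and3P) => [[/forallP h1 /forallP h2 /forall_inP h3]|[h1 h1' h2 h3]].
  split => //.
  - by move=> v vY; have := h1 v; case: (f v) => [a /andP[_ aQ]|]; [exists a|rewrite vY].
  - by move=> v vY; have := h1 v; case: (f v) => [a|//]; rewrite (negbTE vY).
  - by move=> v w a b fv fw; have /forallP/(_ w) := h2 v; rewrite fv fw.
split; last exact/forall_inP.
  apply/forallP => v; have [vY|vY] := boolP (v \in Y); first by have [a -> ->] := h1 v vY.
  by rewrite h1'.
apply/forallP => v; apply/forallP => w; case fv: (f v) => [a|//]; case fw: (f w) => [b|//].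
exact: h2 fv fw.
Qed.

Lemma hits_del u (f : {ffun G -> option C}) x : hits u (upd f x None) = hits u f :\ x.
Proof. by apply/setP => w; rewrite !inE ffunE; case: eqP. Qed.

Lemma level_del (Y : {set G}) x (f : {ffun G -> option C}) :
  f \in level_colorings Y -> upd f x None \in level_colorings (Y :\ x).
Proof.
case/level_coloringsP => h1 h1' h2 h3; apply/level_coloringsP; split.
- by move=> v; rewrite !inE => /andP[vx vY]; rewrite ffunE (negbTE vx); apply: h1.
- by move=> v; rewrite !inE ffunE; case: eqP => //= _; apply: h1'.
- move=> v w a b; rewrite !ffunE; case: eqP => // _ fv; case: eqP => // _; exact: h2.
- move=> u uL; apply: leq_ltn_trans (h3 u uL); rewrite hits_del.
  by apply: subset_leq_card; apply: subD1set.
Qed.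

(** Once the color b of x is prescribed, uncoloring x is injective. *)
Lemma sum_fixed_color (Y : {set G}) x b (h : {ffun G -> option C} -> rat) :
  (forall f, 0 <= h f) -> (forall f, h (upd f x None) = h f) ->
  \sum_(f in level_colorings Y | f x == Some b) h f <=
    \sum_(f in level_colorings (Y :\ x)) h f.
Proof.
move=> h0 hx.
pose A := [set f in level_colorings Y | f x == Some b].
rewrite (_ : \sum_(f in level_colorings Y | f x == Some b) h f = \sum_(f in A) h f); last first.
  by apply: eq_bigl => f; rewrite [RHS]inE.
have inj : {in A &, injective (fun f => upd f x None)}.
  move=> f g; rewrite [f \in A]inE [g \in A]inE => /andP[_ /eqP fx] /andP[_ /eqP gx].
  move=> /ffunP E; apply/ffunP => w; have := E w; rewrite !ffunE.
  by case: eqP => // ->; rewrite fx gx.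
under eq_bigr => f _ do rewrite -hx.
rewrite -(big_imset h inj) /=; set A' := imset _ _.
rewrite [leRHS](bigID (mem A')) /= (_ : \sum_(f in level_colorings (Y :\ x) | f \in A') h f =
  \sum_(f in A') h f); last first.
  apply: eq_bigl => f /=; rewrite andb_idl // => /imsetP[g + ->].
  by rewrite inE => /andP[gY _]; apply: level_del.
by rewrite lerDl; apply: sumr_ge0 => f _; apply: h0.
Qed.

Definition hit_colors (u w : G) : {set C} := [set b in Q w | hit u w b].

Hypothesis Q_gt0 : forall w, w \in T -> (0 < #|Q w|)%N.
Hypothesis deg_le : forall w : G, (deg w <= D)%N.
Hypothesis D_gt0 : (0 < D)%N.
Hypothesis few_conflicts : forall w c, w \in T -> c \in Q w ->
  \sum_(v in T | [exists b in Q v, cf w c v b]) 2 / #|Q v|%:R <= 1 / 4 :> rat.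
Hypothesis few_hits : forall u, u \in Low ->
  8 * D%:R * \prod_(w in T) (1 + 2 * #|hit_colors u w|%:R / #|Q w|%:R) <= 2 ^+ s u :> rat.

(* Removing w from Y divides the number of colorings by at least |Q w| / 2. By
   induction this holds for smaller sets, so in a random coloring of Y minus w,
   prescribing the color of a vertex v costs a factor 2 / |Q v|; hence few pairs
   of such a coloring and a color of w fail to extend to Y. *)
Section Step.
Variable n : nat.
Hypothesis IHn : forall Y : {set G}, (#|Y| < n)%N -> Y \subset T -> forall w, w \in Y ->
  (#|Q w| * #|level_colorings (Y :\ w)| <= 2 * #|level_colorings Y|)%N.

(** Exponential moment of the number of hits in Z. Splitting off x in Z adds the colorings in which
    x hits u. Prescribing such a color of x costs a factor 2 / |Q x| by [IHn] and leaves a coloring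
    of [Y :\ x], whose moment over [Z :\ x] is bounded by induction. *)
Lemma moment_bound u (Z Y : {set G}) : (#|Y| < n)%N -> Y \subset T -> Z \subset T ->
  \sum_(f in level_colorings Y) 2 ^+ #|hits u f :&: Z| <=
  (\prod_(w in Z) (1 + 2 * #|hit_colors u w|%:R / #|Q w|%:R)) * #|level_colorings Y|%:R :> rat.
Proof.
have [N] := ubnP #|Z|; elim: N Z Y => // N IH Z Y ltZ ltY YT ZT.
have [->|[x xZ]] := set_0Vmem Z.
  rewrite big_set0 mul1r -sumr_const; apply: ler_sum => f _.
  by rewrite setI0 cards0 expr0.
have ltZx : (#|Z :\ x| < N)%N by move: ltZ; rewrite (cardsD1 x) xZ.
have ZxT : Z :\ x \subset T by apply: subset_trans ZT; apply: subD1set.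
have xT : x \in T by apply: (subsetP ZT).
rewrite (big_setD1 x) //=; set Pi := \prod_(w in Z :\ x) _.
have Pi0 : 0 <= Pi by apply: prodr_ge0 => w _; rewrite addr_ge0 // divr_ge0 // mulr_ge0.
have Q0 : 0 < #|Q x|%:R :> rat by rewrite ltr0n Q_gt0.
have splitE (f : {ffun G -> option C}) : (2 ^+ #|hits u f :&: Z| : rat) =
    2 ^+ #|hits u f :&: (Z :\ x)| + (if x \in hits u f then 2 ^+ #|hits u f :&: (Z :\ x)| else 0).
  rewrite (cardsD1 x (_ :&: Z)) inE xZ andbT -setIDA exprD.
  by case: ifP => _ /=; rewrite ?expr1 ?expr0; lra.
under eq_bigr => f _ do rewrite splitE.
rewrite big_split /=.
have first := IH (Z :\ x) Y ltZx ltY YT ZxT.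
suff second : \sum_(f in level_colorings Y)
   (if x \in hits u f then 2 ^+ #|hits u f :&: (Z :\ x)| else 0) <=
   (2 * #|hit_colors u x|%:R / #|Q x|%:R) * Pi * #|level_colorings Y|%:R :> rat.
  by apply: le_trans (lerD first second) _; rewrite -/Pi; lra.
rewrite -big_mkcondr /=.
have [xY|xY] := boolP (x \in Y); last first.
  rewrite big1 ?mulr_ge0 ?invr_ge0 // => f /andP[/level_coloringsP[_ h _ _] /hitsP[b]].
  by rewrite h.
apply: le_trans (_ : \sum_(b in hit_colors u x) \sum_(f in level_colorings Y | f x == Some b)
    2 ^+ #|hits u f :&: (Z :\ x)| <= _).
  rewrite (exchange_big_dep (mem (level_colorings Y))) /=; last by move=> b f _ /andP[].
  rewrite [leRHS](bigID (fun f => x \in hits u f)) /= -[leLHS]addr0.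
  apply: lerD; last by apply: sumr_ge0 => f _; apply: sumr_ge0 => b _; apply: exprn_ge0.
  apply: ler_sum => f /andP[/[dup] fY /level_coloringsP[h _ _ _] /hitsP[b fx hb]].
  have bh : b \in hit_colors u x.
    by have [a] := h x xY; rewrite fx => -[<-] bQ; rewrite inE bQ.
  rewrite (bigD1 b) /=; last by rewrite bh fY fx eqxx.
  by rewrite lerDl; apply: sumr_ge0 => c _; apply: exprn_ge0.
have Yx : (#|Y :\ x| < n)%N by apply: leq_ltn_trans ltY; apply/subset_leq_card/subD1set.
have YxT : Y :\ x \subset T by apply: subset_trans YT; apply: subD1set.
apply: le_trans (_ : \sum_(b in hit_colors u x) Pi * #|level_colorings (Y :\ x)|%:R <= _).
  apply: ler_sum => b _; apply: le_trans (IH (Z :\ x) (Y :\ x) ltZx Yx YxT ZxT).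
  apply: sum_fixed_color => f; first exact: exprn_ge0.
  rewrite hits_del; congr (_ ^+ #|pred_of_set _|); apply/setP => w.
  by rewrite !inE; case: eqP; rewrite ?andbF.
rewrite sumr_const -[_ *+ #|_|]mulr_natl.
have := IHn ltY YT xY; rewrite -(ler_nat rat) !natrM => h.
have h' : #|level_colorings (Y :\ x)|%:R <= 2 / #|Q x|%:R * #|level_colorings Y|%:R :> rat.
  by rewrite mulrAC ler_pdivlMr // mulrC.
apply: le_trans (_ : #|hit_colors u x|%:R * (Pi * (2 / #|Q x|%:R * #|level_colorings Y|%:R)) <= _).
  by rewrite ler_wpM2l // ler_wpM2l.
rewrite [leLHS](_ : _ =
  2 * #|hit_colors u x|%:R / #|Q x|%:R * Pi * #|level_colorings Y|%:R) //.
by ring.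
Qed.

(** For each color a of w at least half of the colorings of Y minus w extend: conflicts with a
    exclude at most a quarter, and so do lower neighbors that cannot afford another hit. *)
Lemma level_step (Y : {set G}) w : (#|Y| < n.+1)%N -> Y \subset T -> w \in Y ->
  (#|Q w| * #|level_colorings (Y :\ w)| <= 2 * #|level_colorings Y|)%N.
Proof.
move=> ltY YT wY; set Y' := Y :\ w; set N := #|level_colorings Y'|.
have wT := subsetP YT w wY.
have ltY' : (#|Y'| < n)%N by move: ltY; rewrite (cardsD1 w) wY.
have Y'T : Y' \subset T by apply: subset_trans YT; apply: subD1set.
pose conf a := [set f in level_colorings Y' |
  [exists v, if f v is Some b then cf w a v b else false]].
pose danger := [set f in level_colorings Y' |
  [exists u in Low, edge u w && (s u <= #|hits u f|.+1)%N]].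
pose good a := level_colorings Y' :\: (conf a :|: danger).
have c1 a : a \in Q w -> (#|conf a|%:R <= 1 / 4 * N%:R :> rat).
  move=> aQ; pose U := [set v in T | [exists b in Q v, cf w a v b]].
  apply: le_trans (_ : \sum_(v in U) 2 / #|Q v|%:R * N%:R <= _); last first.
    rewrite -mulr_suml ler_wpM2r //; apply: le_trans (few_conflicts wT aQ).
    by rewrite le_eqVlt; apply/orP; left; apply/eqP/eq_bigl => v; rewrite inE.
  pose F v := [set f in level_colorings Y' | if f v is Some b then cf w a v b else false].
  apply: le_trans (_ : \sum_(v in U) #|F v|%:R <= _).
    rewrite -natr_sum ler_nat; apply: leq_trans (leq_card_bigcup _ _).
    apply/subset_leq_card/subsetP => f; rewrite !inE => /andP[fY /existsP[v hv]].
    apply/bigcupP; exists v; last by rewrite inE fY.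
    case/level_coloringsP: fY => h h' _ _.
    have [vY|vY] := boolP (v \in Y'); last by rewrite h' in hv.
    have [b fv bQ] := h v vY; rewrite inE (subsetP Y'T) //=.
    by apply/existsP; exists b; rewrite bQ; rewrite fv in hv.
  apply: ler_sum => v; rewrite inE => /andP[vT /existsP[b /andP[bQ cb]]].
  have Qv : 0 < #|Q v|%:R :> rat by rewrite ltr0n Q_gt0.
  have [vY|vY] := boolP (v \in Y'); last first.
    rewrite (_ : F v = set0) ?cards0 ?mulr_ge0 ?invr_ge0 //.
    apply/setP => f; rewrite !inE; apply/negP => /andP[/level_coloringsP[_ h _ _]].
    by rewrite h.
  have : (#|F v| <= #|level_colorings (Y' :\ v)|)%N.
    have := @sum_fixed_color Y' v b (fun=> 1) (fun=> ler01) (fun=> erefl).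
    rewrite !sumr_const ler_nat; apply: leq_trans.
    apply/subset_leq_card/subsetP => f; rewrite [f \in F v]inE => /andP[fY].
    case E: (f v) => [b'|//] cb'; apply/andP; split => //.
    by rewrite E (cf_inj cb cb').
  have le1 := IHn ltY' Y'T vY; move=> le2.
  rewrite mulrAC ler_pdivlMr // -!natrM ler_nat mulnC.
  apply: leq_trans le1; by rewrite leq_mul2l le2 orbT.
(* Markov's inequality for 2 to the number of hits. In the 8 D of [few_hits], D pays for the union
   over the neighbors of w, 2 for comparing with s u - 1 instead of s u, and 4 gives the quarter. *)
have c2 : (#|danger|%:R <= 1 / 4 * N%:R :> rat).
  pose U := [set u in Low | edge u w].
  pose F u := [set f in level_colorings Y' | (s u <= #|hits u f|.+1)%N].
  have D0 : 0 < D%:R :> rat by rewrite ltr0n.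
  apply: le_trans (_ : \sum_(u in U) #|F u|%:R <= _).
    rewrite -natr_sum ler_nat; apply: leq_trans (leq_card_bigcup _ _).
    apply/subset_leq_card/subsetP => f; rewrite !inE => /andP[fY /existsP[u /and3P[uL uw su]]].
    by apply/bigcupP; exists u; rewrite inE ?fY ?uL.
  apply: le_trans (_ : \sum_(u in U) (1 / 4 * N%:R / D%:R) <= _); last first.
    rewrite sumr_const -[_ *+ #|_|]mulr_natr mulrAC (ler_pdivrMr _ _ D0) ler_wpM2l ?mulr_ge0 //.
    rewrite ler_nat; apply: leq_trans (deg_le w); apply/subset_leq_card/subsetP => u.
    by rewrite !inE edge_sym => /andP[].
  apply: ler_sum => u; rewrite inE => /andP[uL _].
  have := moment_bound u ltY' Y'T (subxx T); set Pi := \prod_(x in T) _ => mom.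
  have hF : 2 ^+ s u * #|F u|%:R <= 2 * (Pi * N%:R) :> rat.
    apply: le_trans (ler_wpM2l _ mom) => //.
    rewrite mulr_natr -sumr_const mulr_sumr [leRHS](bigID (mem (F u))) /=.
    rewrite (_ : \sum_(f in _ | f \in F u) _ =
      \sum_(f in F u) 2 * 2 ^+ #|hits u f :&: T|); last first.
      by apply: eq_bigl => f; rewrite andb_idl // inE => /andP[].
    rewrite -[leLHS]addr0; apply: lerD; last first.
      by apply: sumr_ge0 => f _; rewrite mulr_ge0 // exprn_ge0.
    apply: ler_sum => f; rewrite inE => /andP[/level_coloringsP[_ h _ _] sf].
    rewrite -exprS; apply: ler_weXn2l => //; apply: leq_trans sf _; rewrite ltnS.
    apply/subset_leq_card/subsetP => x xh; rewrite inE xh /=.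
    case/hitsP: xh => b; have [xY _ _|xY] := boolP (x \in Y'); first exact: (subsetP Y'T).
    by rewrite h.
  have := few_hits uL; rewrite -/Pi => hs.
  have p2 : 0 < 2 ^+ s u :> rat by apply: exprn_gt0.
  rewrite (ler_pdivlMr _ _ D0).
  have hs' : 8 * D%:R * Pi * N%:R <= 2 ^+ s u * N%:R by apply: ler_wpM2r.
  have hF' : D%:R * (2 ^+ s u * #|F u|%:R) <= D%:R * (2 * (Pi * N%:R)).
    by apply: ler_wpM2l.
  rewrite -(ler_pM2l p2); lra.
have c3 a : a \in Q w -> (N%:R <= 2 * #|good a|%:R :> rat).
  move=> aQ; have := cardsID (conf a :|: danger) (level_colorings Y').
  have : (#|level_colorings Y' :&: (conf a :|: danger)| <= #|conf a| + #|danger|)%N.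
    apply: leq_trans (leq_card_setU _ _); apply: subset_leq_card; apply: subsetIr.
  rewrite -(ler_nat rat) natrD => le1 /(congr1 (fun k => k%:R : rat)).
  rewrite natrD -/N -/(good a) => E; have := c1 a aQ; lra.
have c4 : (\sum_(a in Q w) #|good a| <= #|level_colorings Y|)%N.
  pose H a := [set upd f w (Some a) | f in good a].
  have fw f a : f \in good a -> f w = None.
    rewrite !inE => /andP[_ /level_coloringsP[_ h _ _]].
    by apply: h; rewrite !inE eqxx.
  apply: leq_trans (_ : \sum_(a in Q w) #|H a| <= _)%N.
    apply: leq_sum => a _; rewrite card_in_imset // => f g fa ga /ffunP E.
    apply/ffunP => x; have := E x; rewrite !ffunE; case: eqP => // -> _.
    by rewrite (fw f a) // (fw g a).
  apply: leq_trans (_ : \sum_(a in Q w) #|[set f in level_colorings Y | f w == Some a]| <= _)%N.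
    apply: leq_sum => a aQ; apply/subset_leq_card/subsetP => _ /imsetP[f + ->].
    move=> /[dup] /fw fw0; rewrite in_setD in_setU negb_or => /andP[/andP[nc nd] fY'].
    rewrite [_ \in [set _ in _ | _]]inE {2}/upd ffunE eqxx eqxx andbT.
    case/level_coloringsP: (fY') => h1 h1' h2 h3.
    have nc' v b : f v = Some b -> ~~ cf w a v b.
      move=> fv; apply: contra nc => cb; rewrite inE fY'; apply/existsP; exists v.
      by rewrite fv.
    apply/level_coloringsP; split.
    - move=> v vY; rewrite ffunE; have [->|vw] := eqVneq v w; first by exists a.
      by apply: h1; rewrite !inE vw.
    - move=> v vY; rewrite ffunE; have [vw|vw] := eqVneq v w; first by rewrite vw wY in vY.
      by apply: h1'; rewrite !inE (negbTE vY) andbF.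
    - move=> v x b b'; rewrite !ffunE; case: eqP => [-> [<-]|_ fv]; case: eqP => [-> [<-]|_ fx].
      + by apply/negP => /cf_edge; rewrite edge_irr.
      + exact: nc'.
      + by rewrite cf_sym; apply: nc'.
      + exact: h2 fv fx.
    - move=> u uL; have sub : hits u (upd f w (Some a)) \subset w |: hits u f.
        apply/subsetP => x /hitsP[b]; rewrite ffunE in_setU1; case: eqP => //= _ fx hx.
        by apply/hitsP; exists b.
      have [uw|uw] := boolP (edge u w).
        apply: leq_ltn_trans (subset_leq_card sub) _; rewrite cardsU1.
        have : ~~ (s u <= #|hits u f|.+1)%N.
          apply: contra nd => su; rewrite inE fY'; apply/existsP; exists u.
          by rewrite uL uw.
        by rewrite -ltnNge; apply: leq_ltn_trans; rewrite -add1n leq_add2r leq_b1.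
      apply: leq_ltn_trans (h3 u uL); apply/subset_leq_card/subsetP => x.
      move=> /hitsP[b]; rewrite ffunE; case: eqP => [-> _ /hit_edge h|_ fx hx].
        by rewrite h in uw.
      by apply/hitsP; exists b.
  apply: leq_trans (_ : \sum_(a in Q w) \sum_(f in level_colorings Y | f w == Some a) 1 <= _)%N.
    by apply: leq_sum => a _; rewrite sum1dep_card.
  rewrite (exchange_big_dep (mem (level_colorings Y))) //=; last by move=> a f _ /andP[].
  rewrite -[leqRHS]sum1_card; apply: leq_sum => f _.
  rewrite sum1dep_card; apply: card_le1 => a a'; rewrite !in_set.
  by move=> /and3P[_ _ /eqP ->] /and3P[_ _ /eqP []].
have c5 : \sum_(a in Q w) N%:R <= \sum_(a in Q w) 2 * #|good a|%:R :> rat by apply: ler_sum.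
rewrite -(ler_nat rat) !natrM.
rewrite sumr_const -[_ *+ _]mulr_natl -mulr_sumr -natr_sum in c5.
apply: le_trans c5 _; by rewrite ler_wpM2l // ler_nat.
Qed.
End Step.

Lemma level_ratio (Y : {set G}) w : Y \subset T -> w \in Y ->
  (#|Q w| * #|level_colorings (Y :\ w)| <= 2 * #|level_colorings Y|)%N.
Proof.
have [n] := ubnP #|Y|; elim: n Y w => // n IH Y w ltY.
by apply: (level_step (n := n)) => // Z ltZ ZT x; apply: IH.
Qed.

Lemma level_coloring_exists : exists f, f \in level_colorings T.
Proof.
suff h (Y : {set G}) : Y \subset T -> (0 < #|level_colorings Y|)%N.
  by have /card_gt0P[f fT] := h T (subxx T); exists f.
have [n] := ubnP #|Y|; elim: n Y => // n IH Y ltY YT.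
have [->|[w wY]] := set_0Vmem Y.
  apply/card_gt0P; exists [ffun=> None]; apply/level_coloringsP; split.
  - by move=> v; rewrite inE.
  - by move=> v _; rewrite ffunE.
  - by move=> v w a b; rewrite ffunE.
  - move=> u uL; rewrite (_ : hits _ _ = set0) ?cards0; last first.
      by apply/setP => w; rewrite inE ffunE inE.
    (* The empty coloring needs s u > 0, which [few_hits] forces because its left side is at least
       8. *)
    rewrite lt0n; apply/eqP => s0; have := few_hits uL; rewrite s0 expr0.
    have : 1 <= \prod_(w in T) (1 + 2 * #|hit_colors u w|%:R / #|Q w|%:R) :> rat.
      apply: (big_ind (fun x : rat => 1 <= x)) => // [x y x1 y1|w _]; first by nra.
      by rewrite lerDl divr_ge0 // mulr_ge0.
    have : 1 <= D%:R :> rat by rewrite ler1n.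
    nra.
have := level_ratio YT wY; rewrite lt0n; apply: contraTneq => ->.
rewrite muln0 leqn0 muln_eq0 negb_or -!lt0n Q_gt0 ?(subsetP YT) //=.
apply: IH; last by apply: subset_trans YT; apply: subD1set.
by move: ltY; rewrite (cardsD1 w) wY.
Qed.
End LevelColoring.

(** * Coloring all degree levels *)

(** The inverse (1 - 1/(N + 1))^N is at least 1/4: each half of the exponent contributes at least
    1/2 by Bernoulli. *)
Lemma expr_one_add_inv (R : realFieldType) (N : nat) : (0 < N)%N ->
  (1 + N%:R^-1 : R) ^+ N <= 4.
Proof.
move=> N0; have N0' : 0 < N%:R :> R by rewrite ltr0n.
set x := (N.+1%:R^-1 : R).
have x0 : 0 < x by rewrite invr_gt0 ltr0n.
have x1 : x <= 1 by rewrite invf_le1 ?ler1n ?ltr0n.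
have inv : (1 + N%:R^-1) * (1 - x) = 1.
  by rewrite /x -natr1; field; rewrite ?natr1 ?pnatr_eq0 //; lia.
have half q : (2 * q <= N.+1)%N -> 1 / 2 <= (1 - x) ^+ q.
  move=> qN; apply: le_trans (bernoulli _ _); last by lra.
  have : q%:R * x <= 1 / 2.
    rewrite ler_pdivrMr ?ltr0n //; move: qN; rewrite -(ler_nat R) natrM; lra.
  lra.
have h : 1 / 4 <= (1 - x) ^+ N.
  rewrite -(odd_double_half N) -addnn addnA exprD.
  have h1 := half (odd N + N./2)%N; have h2 := half N./2.
  have := odd_double_half N; rewrite -addnn => E.
  have {}h1 : 1 / 2 <= (1 - x) ^+ (odd N + N./2) by apply: h1; lia.
  have {}h2 : 1 / 2 <= (1 - x) ^+ N./2 by apply: h2; lia.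
  nra.
have : (1 + N%:R^-1) ^+ N * (1 - x) ^+ N = 1 by rewrite -exprMn inv expr1n.
have : 0 <= (1 + N%:R^-1 : R) ^+ N by apply: exprn_ge0; rewrite addr_ge0 // invr_ge0 ltW.
nra.
Qed.

Section SecondPhase.
Variables (G : sgraph) (C : finType) (L : G -> {set C}).
Variable cf : G -> C -> G -> C -> bool.
Hypothesis cf_edge : forall u a v b, cf u a v b -> edge u v.
Hypothesis cf_sym : forall u a v b, cf u a v b = cf v b u a.
Hypothesis cf_inj : forall u a v b b', cf u a v b -> cf u a v b' -> b = b'.

Variables (lev l M s : G -> nat) (D : nat).
Hypothesis deg_le : forall w : G, (deg w <= D)%N.
Hypothesis D_gt0 : (0 < D)%N.
Hypothesis l_gt0 : forall v, (0 < l v)%N.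
Hypothesis same_level : forall v w : G, lev v = lev w -> (16 * M w <= l v)%N.
Hypothesis lower_level : forall v w : G, (lev v < lev w)%N -> (l v <= l w)%N.
Hypothesis loss : forall v : G, (8 * D * 2 ^ (8 * M v) <= 2 ^ s v)%N.

(** A color of w that hits u is matched to some c in [Q u], and each c is matched to at most one
    color of w, so counting pairs (c, w) suffices. *)
Lemma sum_hit_colors (Q : G -> {set C}) (T : {set G}) u :
  (\sum_(w in T) #|hit_colors cf Q u w| <=
   \sum_(c in Q u) #|[set w in T | [exists b in Q w, cf u c w b]]|)%N.
Proof.
apply: leq_trans (_ : \sum_(w in T) \sum_(c in Q u | [exists b in Q w, cf u c w b]) 1 <= _)%N.
  apply: leq_sum => w _; rewrite sum1dep_card.
  apply: leq_trans (_ : #|\bigcup_(c in [set c in Q u | [exists b in Q w, cf u c w b]])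
     [set b | cf u c w b]| <= _)%N.
    apply/subset_leq_card/subsetP => b; rewrite inE => /andP[bQ /existsP[c /andP[cQ cb]]].
    apply/bigcupP; exists c; rewrite inE // cQ; apply/existsP; exists b; by rewrite bQ.
  apply: leq_trans (leq_card_bigcup _ _) _; rewrite -[leqRHS]sum1_card.
  apply: leq_sum => c _; apply: card_le1 => b b'; rewrite !inE; exact: cf_inj.
rewrite (exchange_big_dep (mem (Q u))) //=; last by move=> w c _ /andP[].
apply: leq_sum => c cQ; rewrite sum1dep_card; apply/subset_leq_card/subsetP => w.
by rewrite !inE => /and3P[-> _ ->].
Qed.

(** Lists at higher levels have size at least l u / 2, so by Bernoulli a factor with h hitting
    colors is at most (1 + 1 / l u)^(4 h). These h sum to at most l u M u, and (1 + 1/n)^n <= 4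
    bounds the product by 2^(8 M u). *)
Lemma level_hits (Q : G -> {set C}) (T : {set G}) u :
  (forall w, w \in T -> lev u < lev w)%N ->
  (forall w, w \in T -> l w <= 2 * #|Q w|)%N -> (#|Q u| <= l u)%N ->
  (forall c, c \in Q u -> #|[set w in T | [exists b in Q w, cf u c w b]]| <= M u)%N ->
  8 * D%:R * \prod_(w in T) (1 + 2 * #|hit_colors cf Q u w|%:R / #|Q w|%:R)
     <= 2 ^+ s u :> rat.
Proof.
move=> levT QT Qu Mu.
apply: le_trans (_ : (8 * D * 2 ^ (8 * M u))%:R <= _); last first.
  by rewrite -natrX ler_nat.
rewrite 2!natrM; apply: ler_wpM2l; first by rewrite mulr_ge0.
have lu : 0 < (l u)%:R :> rat by rewrite ltr0n.
set y : rat := 1 + (l u)%:R^-1.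
have y1 : 1 <= y by rewrite /y lerDl invr_ge0 ltW.
apply: le_trans (_ : \prod_(w in T) y ^+ (4 * #|hit_colors cf Q u w|) <= _).
  apply: ler_prod => w wT; rewrite addr_ge0 ?divr_ge0 ?mulr_ge0 //=.
  have lw : 0 < (l w)%:R :> rat by rewrite ltr0n.
  have Qw0 : 0 < #|Q w|%:R :> rat.
    rewrite ltr0n; have := QT w wT; have := l_gt0 w; lia.
  apply: le_trans (bernoulli _ _); last by rewrite (le_trans _ (ltW (_ : 0 < _))) ?invr_gt0.
  have h : 2 / #|Q w|%:R <= 4 / (l u)%:R :> rat.
    rewrite ler_pdivrMr // mulrAC ler_pdivlMr // -natrM -natrM ler_nat.
    have := QT w wT; have := lower_level (levT w wT); lia.
  rewrite lerD2l natrM.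
  rewrite [leLHS](_ : _ = #|hit_colors cf Q u w|%:R * (2 / #|Q w|%:R)); last by ring.
  rewrite [leRHS](_ : _ = #|hit_colors cf Q u w|%:R * (4 / (l u)%:R)); last by ring.
  exact: ler_wpM2l.
rewrite prodrXr -big_distrr /=.
apply: le_trans (_ : y ^+ (l u * (4 * M u)) <= _).
  apply: ler_weXn2l => //; rewrite mulnCA leq_mul2l /=.
  apply: leq_trans (sum_hit_colors _ _ _) _.
  apply: leq_trans (_ : \sum_(c in Q u) M u <= _)%N; first exact: leq_sum.
  by rewrite sum_nat_const leq_mul2r Qu orbT.
rewrite exprM natrX (_ : (8 * M u = 2 * (4 * M u))%N); last by lia.
rewrite [leRHS]exprM -natrX; apply: lerXn2r; rewrite ?nnegrE ?exprn_ge0 ?(le_trans ler01) //.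
exact: expr_one_add_inv.
Qed.

(** There are at most M w terms, each at most 1/(4 M w) because |Q v| >= l v / 2 >= 8 M w. *)
Lemma level_conflicts (Q : G -> {set C}) (T : {set G}) w c :
  (forall v, v \in T -> lev v = lev w) ->
  (forall v, v \in T -> l v <= 2 * #|Q v|)%N ->
  (#|[set v in T | [exists b in Q v, cf w c v b]]| <= M w)%N ->
  \sum_(v in T | [exists b in Q v, cf w c v b]) 2 / #|Q v|%:R <= 1 / 4 :> rat.
Proof.
move=> levT QT Mw; set U := [set v in T | _] in Mw.
have Q8 v : v \in T -> 8 * (M w)%:R <= #|Q v|%:R :> rat.
  move=> vT; rewrite -natrM ler_nat.
  have := QT v vT; have := same_level (levT v vT); lia.
have Q0 v : v \in T -> 0 < #|Q v|%:R :> rat.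
  move=> vT; rewrite ltr0n; have := QT v vT; have := l_gt0 v; lia.
rewrite -(ler_nat rat) in Mw.
clear levT QT same_level lower_level loss deg_le.
rewrite (_ : \sum_(v in T | _) _ = \sum_(v in U) 2 / #|Q v|%:R); last first.
  by apply: eq_bigl => v; rewrite [RHS]inE.
have [M0|M0] := posnP (M w).
  by move: Mw; rewrite M0 lern0 cards_eq0 => /eqP ->; rewrite big_set0.
have M0' : 0 < (M w)%:R :> rat by rewrite ltr0n.
apply: le_trans (_ : \sum_(v in U) (1 / 4 / (M w)%:R) <= _).
  apply: ler_sum => v; rewrite inE => /andP[vT _].
  rewrite (ler_pdivrMr _ _ (Q0 v vT)) mulrAC (ler_pdivlMr _ _ M0').
  have := Q8 v vT; lra.
rewrite sumr_const -[_ *+ #|_|]mulr_natr mulrAC (ler_pdivrMr _ _ M0').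
exact: ler_wpM2l.
Qed.

(** Induction on the number of levels left, the highest being colored. A level takes at most s v
    colors from v, so the slack 2 J s v pays for all levels and the list never falls below l v / 2.
    Shrinking lists only lowers conflict degrees. *)
Lemma second_phase (J : nat) (f : {ffun G -> option C}) (Q : G -> {set C}) :
  f \in partials L cf ->
  (forall v, f v = None -> lev v < J)%N ->
  (forall v c, f v = None -> c \in Q v -> avail L cf f v c) ->
  (forall v, f v = None -> l v + 2 * J * s v <= 2 * #|Q v|)%N ->
  (forall v, f v = None -> #|Q v| <= l v)%N ->
  (forall v c, f v = None -> c \in Q v ->
     #|[set u | (f u == None) && [exists a in Q u, cf v c u a]]| <= M v)%N ->
  exists phi : G -> C, forall u, phi u \in L u /\ forall v, ~~ cf u (phi u) v (phi v).
Proof.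
elim: J f Q => [|J IH] f Q fW levJ avQ QJ Ql QM.
  have tot u : exists c, f u = Some c by case E: (f u) => [c|]; [exists c|have := levJ u E].
  have [phi phiE] : exists phi : G -> C, forall u, f u = Some (phi u).
    (* [odflt] needs an element of C. If C is empty, so is G, since every vertex has a color. *)
    case: (pickP (fun _ : C => true)) => [c0 _|noC].
      exists (fun u => odflt c0 (f u)) => u; by have [c ->] := tot u.
    case: (pickP (fun _ : G => true)) => [u0 _|noG].
      by have [c _] := tot u0; have := noC c.
    have H (u : G) : False by have := noG u.
    by exists (fun u => match H u with end) => u; case: (H u).
  exists phi => u; have /availP[uL nb] := partialsP _ _ _ fW _ _ (phiE u).
  by split=> // v; apply: nb.
pose T := [set v | (f v == None) && (lev v == J)].
pose Low := [set v | (f v == None) && (lev v < J)%N].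
have Tlev v : v \in T -> lev v = J by rewrite inE => /andP[_ /eqP].
have Tf v : v \in T -> f v = None by rewrite inE => /andP[/eqP].
have Lowf v : v \in Low -> f v = None by rewrite inE => /andP[/eqP].
have Lowlev v : v \in Low -> (lev v < J)%N by rewrite inE => /andP[].
have Q2 v : f v = None -> (l v <= 2 * #|Q v|)%N.
  by move=> fv; apply: leq_trans (QJ v fv); apply: leq_addr.
have sub v c : f v = None -> c \in Q v ->
    (#|[set w in T | [exists b in Q w, cf v c w b]]| <= M v)%N.
  move=> fv cQ; apply: leq_trans (QM v c fv cQ); apply/subset_leq_card/subsetP => w.
  by rewrite !inE => /andP[/andP[-> _] ->].
have [phi] : exists g, g \in level_colorings cf Q Low s T.
  apply: (@level_coloring_exists G C cf cf_edge cf_sym cf_inj Q T Low s D) => //.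
  - move=> w wT; have := Q2 w (Tf w wT); have := l_gt0 w; lia.
  - move=> w c wT cQ; apply: level_conflicts => [v vT|v vT|]; first by rewrite !Tlev.
      exact/Q2/Tf.
    exact: sub (Tf _ wT) cQ.
  - move=> u uL; apply: level_hits => [w wT|w wT||c cQ].
    + by rewrite (Tlev w wT); apply: Lowlev.
    + exact/Q2/Tf.
    + exact/Ql/Lowf.
    + exact: sub (Lowf _ uL) cQ.
case/level_coloringsP => p1 p2 p3 p4.
pose f' := [ffun v => if v \in T then phi v else f v].
pose blocked u := [set c | [exists w in T, if phi w is Some b then cf u c w b else false]].
pose Q' u := Q u :\: blocked u.
have f'N v : f' v = None -> v \in Low.
  rewrite ffunE; case: ifP => [vT|vT fv]; first by have [a ->] := p1 v vT.
  have := levJ v fv; rewrite inE fv eqxx /= ltnS leq_eqVlt => /orP[/eqP E|//].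
  by rewrite inE fv eqxx E eqxx in vT.
have f'T v : v \in T -> f' v = phi v by move=> vT; rewrite ffunE vT.
have f'F v : v \notin T -> f' v = f v by move=> vT; rewrite ffunE (negbTE vT).
apply: (IH f' Q').
- apply/partialsP => u a; have [uT|uT] := boolP (u \in T).
    rewrite f'T // => pu; have [b] := p1 u uT; rewrite pu => -[<-] aQ.
    have /availP[aL nb] := avQ u a (Tf u uT) aQ.
    apply/availP; split => // w d; have [wT|wT] := boolP (w \in T).
      by rewrite f'T //; apply: p3 pu.
    by rewrite f'F //; apply: nb.
  rewrite f'F // => fu; have /availP[aL nb] := partialsP _ _ _ fW _ _ fu.
  apply/availP; split => // w d; have [wT|wT] := boolP (w \in T).
    rewrite f'T // => pw; have [b] := p1 w wT; rewrite pw => -[<-] dQ.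
    have /availP[_ nb'] := avQ w d (Tf w wT) dQ.
    by rewrite cf_sym; apply: nb' fu.
  by rewrite f'F //; apply: nb.
- by move=> v /f'N/Lowlev.
- move=> v c /f'N vL; rewrite inE => /andP[cB cQ].
  have /availP[cL nb] := avQ v c (Lowf v vL) cQ.
  apply/availP; split => // w d; have [wT|wT] := boolP (w \in T).
    rewrite f'T // => pw; apply: contra cB => cd; rewrite inE; apply/existsP; exists w.
    by rewrite wT pw.
  by rewrite f'F //; apply: nb.
- move=> v /f'N vL; have := QJ v (Lowf v vL).
  have : (#|Q v :&: blocked v| <= s v)%N.
    apply: leq_trans (ltnW (p4 v vL)).
    apply: leq_trans (_ : #|\bigcup_(w in hits cf Q v phi)
      [set c | if phi w is Some b then cf v c w b else false]| <= _)%N.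
      apply/subset_leq_card/subsetP => c; rewrite !inE => /andP[cQ /existsP[w /andP[wT cw]]].
      apply/bigcupP; exists w; last by rewrite inE.
      rewrite inE; move: cw; case: (phi w) => // b cb.
      by apply/existsP; exists c; rewrite cQ.
    apply: leq_trans (leq_card_bigcup _ _) _; rewrite -[leqRHS]sum1_card.
    apply: leq_sum => w _; apply: card_le1 => c c'; rewrite !inE.
    case: (phi w) => // b h h'; rewrite cf_sym in h; rewrite cf_sym in h'; exact: cf_inj h h'.
  have := cardsID (blocked v) (Q v); rewrite -/(Q' v); rewrite mulnS mulnDl; lia.
- move=> v /f'N/Lowf/Ql; apply: leq_trans; apply/subset_leq_card/subsetDl.
- move=> v c /f'N/Lowf fv; rewrite inE => /andP[_ cQ].
  apply: leq_trans (QM v c fv cQ); apply/subset_leq_card/subsetP => u.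
  rewrite in_set => /andP[/eqP/f'N/Lowf fu /existsP[a /andP[+ ca]]].
  rewrite in_setD => /andP[_ aQ].
  by rewrite inE fu eqxx; apply/existsP; exists a; rewrite aQ.
Qed.
End SecondPhase.

Lemma subset_of_card (T : finType) (A : {set T}) n : (n <= #|A|)%N ->
  exists2 B : {set T}, B \subset A & #|B| = n.
Proof.
move=> nA; exists [set x in take n (enum A)].
  by apply/subsetP => x; rewrite inE => /mem_take; rewrite mem_enum.
rewrite cardsE (card_uniqP _) ?size_takel -?cardE //.
by rewrite take_uniq // enum_uniq.
Qed.

Section TwoPhases.
Variables (G : sgraph) (C : finType) (L : G -> {set C}).
Variable cf : G -> C -> G -> C -> bool.
Hypothesis cf_edge : forall u a v b, cf u a v b -> edge u v.
Hypothesis cf_sym : forall u a v b, cf u a v b = cf v b u a.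
Hypothesis cf_inj : forall u a v b b', cf u a v b -> cf u a v b' -> b = b'.

Lemma kept_avail (f : {ffun G -> option C}) v c :
  c \in kept L cf v f -> avail L cf f v c.
Proof.
rewrite inE => /andP[cL /eqP c0]; apply/availP; split=> // w b fw; apply/negP => cb.
have : w \in cls cf v c f by apply/clsP; exists b.
by rewrite c0 inE.
Qed.

Definition open_conflicts (f : {ffun G -> option C}) (v : G) (c : C) : {set G} :=
  [set u | (f u == None) && [exists a in kept L cf u f, cf v c u a]].

(** A conflict of c with a kept color a of u is charged to the addable pair (u, a): kept colors are
    available, and (u, a) is matched to only one color of v. *)
Lemma sum_open_conflicts (f : {ffun G -> option C}) v :
  (\sum_(c in kept L cf v f) #|open_conflicts f v c| <= #|addable L cf v f|)%N.
Proof.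
pose node c := [set x in addable L cf v f | cf v c x.1 x.2].
apply: leq_trans (_ : \sum_(c in kept L cf v f)
    \sum_(x in addable L cf v f | cf v c x.1 x.2) 1 <= _)%N.
  apply: leq_sum => c cK; rewrite sum1dep_card -/(node c).
  apply: leq_trans (_ : #|[set x.1 | x in node c]| <= _)%N; last exact: leq_imset_card.
  apply/subset_leq_card/subsetP => u; rewrite inE => /andP[fu /existsP[a /andP[aK ca]]].
  apply/imsetP; exists (u, a) => //; rewrite in_set ca andbT in_set /= fu (kept_avail aK) /= inE.
  rewrite (cf_edge ca) /=; apply/existsP; exists c; rewrite ca andbT.
  by move: cK; rewrite in_set => /andP[].
rewrite (exchange_big_dep (mem (addable L cf v f))) //=; last by move=> c x _ /andP[].
rewrite -[leqRHS]sum1_card; apply: leq_sum => x _; rewrite sum1dep_card.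
apply: card_le1 => c c'; rewrite !in_set => /and3P[_ _ h] /and3P[_ _ h'].
by rewrite cf_sym in h; rewrite cf_sym in h'; apply: cf_inj h h'.
Qed.

(** By averaging over addable pairs, fewer than l v of the 2 l v kept colors have more than M v open
    conflicts. Of the others, l v form the list for the second phase, where 2 J s v <= l v covers
    the losses of J levels. *)
Lemma two_phase_coloring (D m J : nat) (T K l M s lev : G -> nat) :
  (forall v : G, 0 < deg v <= D)%N ->
  (8 * (D ^ 2 + D ^ 3) <= 2 ^ m)%N ->
  (forall v, (2 <= T v)%N /\ (0 < K v)%N) ->
  (forall v, occupancy v (T v) (K v)) ->
  (forall v, 3 * deg v <= #|L v| * K v)%N ->
  (forall v, 4 * T v * (3 * m + 6 * l v) <= #|L v|)%N ->
  (forall v, m * (#|L v| + deg v) + 2 * deg v <= M v * l v)%N ->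
  (forall v, 0 < l v)%N ->
  (forall v, lev v < J)%N ->
  (forall v w, lev v = lev w -> (16 * M w <= l v)%N) ->
  (forall v w, (lev v < lev w)%N -> (l v <= l w)%N) ->
  (forall v : G, 8 * D * 2 ^ (8 * M v) <= 2 ^ s v)%N ->
  (forall v, 2 * J * s v <= l v)%N ->
  exists phi : G -> C, forall u, phi u \in L u /\ forall v, ~~ cf u (phi u) v (phi v).
Proof.
move=> degD Dm TK occ Kk lk zM l0 levJ same low loss Js.
have [f fW fK] := first_phase cf_edge cf_sym cf_inj degD Dm TK occ Kk lk.
have H v : exists Q : {set C},
    [/\ Q \subset kept L cf v f, #|Q| = l v &
        forall c, c \in Q -> (#|open_conflicts f v c| <= M v)%N].
  have [k1 k2] := fK v.
  pose B := [set c in kept L cf v f | (M v < #|open_conflicts f v c|)%N].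
  have cB : (#|B| < l v)%N.
    have : (\sum_(c in B) M v <= #|addable L cf v f|)%N.
      apply: leq_trans (sum_open_conflicts f v).
      apply: leq_trans (_ : \sum_(c in B) #|open_conflicts f v c| <= _)%N.
        by apply: leq_sum => c; rewrite in_set => /andP[_ /ltnW].
      rewrite [leqRHS](bigID (mem B)) /= (_ : \sum_(c in kept L cf v f | c \in B) _ =
        \sum_(c in B) #|open_conflicts f v c|)%N ?leq_addr //.
      by apply: eq_bigl => c; rewrite andb_idl // in_set => /andP[].
    rewrite sum_nat_const => le1; have := leq_ltn_trans le1 (leq_trans k2 (zM v)).
    by rewrite [ltnRHS]mulnC ltn_mul2r => /andP[].
  have : (l v <= #|kept L cf v f :\: B|)%N.
    have := cardsID B (kept L cf v f).
    have : (#|kept L cf v f :&: B| <= #|B|)%N by apply/subset_leq_card/subsetIr.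
    lia.
  case/subset_of_card => Q /subsetP QB cQ; exists Q; split => //.
    by apply/subsetP => c /QB; rewrite in_setD => /andP[].
  move=> c /QB; rewrite in_setD => /andP[cB' cK].
  by rewrite leqNgt; apply: contra cB' => lt; rewrite in_set cK.
have [Q QP] := fin_all_exists H.
have dD (w : G) : (deg w <= D)%N by case/andP: (degD w).
case: (pickP (fun _ : G => true)) => [v0 _|noG]; last first.
  have nG (u : G) : False by have := noG u.
  by exists (fun u => match nG u with end) => u; case: (nG u).
have D0 : (0 < D)%N by case/andP: (degD v0) => h1 h2; apply: leq_trans h1 h2.
apply: (second_phase cf_edge cf_sym cf_inj dD D0 l0 same low loss (J := J) fW (Q := Q)).
- by move=> v _.
- by move=> v c _ cQ; apply: kept_avail; have [/subsetP + _ _] := QP v; apply.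
- move=> v _; have [_ -> _] := QP v; have := Js v; lia.
- by move=> v _; have [_ -> _] := QP v.
- move=> v c _ cQ; have [_ _ h] := QP v; apply: leq_trans (h c cQ).
  apply/subset_leq_card/subsetP => u; rewrite !in_set => /andP[-> /existsP[a /andP[aQ ca]]].
  apply/existsP; exists a; rewrite ca andbT.
  by have [/subsetP + _ _] := QP u; apply.
Qed.
End TwoPhases.

(** * Sizes of independent sets *)

Section RamseyCounting.
Local Open Scope nat_scope.

Lemma leq_expl m n k : m <= n -> m ^ k <= n ^ k.
Proof. by case: k => // k mn; rewrite leq_exp2r. Qed.

Section IndependentSets.
Variables (V : finType) (e : rel V).
Hypothesis e_sym : symmetric e.
Hypothesis e_irr : irreflexive e.
Implicit Types X Y S K : {set V}.

Definition e_clique K := forall x y, x \in K -> y \in K -> x != y -> e x y.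

(** The Erdős-Szekeres bound: by Pascal's rule the neighbors or the non-neighbors of a vertex x are
    numerous enough for induction, and x extends a clique in the former or an independent set in the
    latter. *)
Lemma ramsey p q X : 'C(p + q, p) <= #|X| ->
  (exists K, [/\ K \subset X, #|K| = p.+1 & e_clique K]) \/
  (exists S, #|S| = q.+1 /\ S \in indsets X e).
Proof.
have [n] := ubnP (p + q); elim: n p q X => // n IH p q X ltn lX.
have [x xX] : exists x, x \in X.
  by apply/card_gt0P; apply: leq_trans lX; rewrite bin_gt0 leq_addr.
have sx : [set x] \subset X by rewrite sub1set.
case: p ltn lX => [|p] ltn lX.
  left; exists [set x]; split=> //; first by rewrite cards1.
  by move=> y z /set1P-> /set1P->; rewrite eqxx.
case: q ltn lX => [|q] ltn lX.
  right; exists [set x]; split; first by rewrite cards1.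
  by apply/indsetsP; split=> // y z /set1P-> /set1P->; rewrite e_irr.
pose A := [set y in X | e x y]; pose B := [set y in X | (y != x) && ~~ e x y].
have cX : #|X| <= (#|A| + #|B|).+1.
  rewrite (cardsD1 x X) xX add1n ltnS; apply: leq_trans (leq_card_setU A B).
  apply/subset_leq_card/subsetP => y; rewrite !inE => /andP[yx yX].
  by rewrite yX yx /=; case: (e x y).
have sA : A \subset X by apply/subsetP => y; rewrite inE => /andP[].
have sB : B \subset X by apply/subsetP => y; rewrite inE => /andP[].
have : 'C(p + q.+1, p) <= #|A| \/ 'C(p.+1 + q, p.+1) <= #|B|.
  move: lX; rewrite addSn binS addSnnS => lX.
  case: (leqP 'C(p + q.+1, p) #|A|) => hA; first by left.
  by right; move: (leq_trans lX cX); lia.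
case=> [hA|hB].
  have lt1 : p + q.+1 < n by lia.
  case: (IH p q.+1 A lt1 hA) => [].
    move=> [K [KA cK clK]]; left; exists (x |: K); split.
    - by rewrite subUset sx (subset_trans KA).
    - rewrite cardsU1 cK; suff -> : x \notin K by [].
      by apply/negP => /(subsetP KA); rewrite inE e_irr andbF.
    - have xK y : y \in K -> e x y by move=> /(subsetP KA); rewrite inE => /andP[].
      move=> y z /setU1P[->|yK] /setU1P[->|zK]; rewrite ?eqxx // => yz.
      + exact: xK.
      + by rewrite e_sym; apply: xK.
      + exact: clK.
  move=> [S [cS /indsetsP[SA indS]]]; right; exists S; split=> //.
  by apply/indsetsP; split=> //; apply: subset_trans sA.
have lt2 : p.+1 + q < n by lia.
case: (IH p.+1 q B lt2 hB) => [].
  move=> [K [KB cK clK]]; left; exists K; split=> //; exact: subset_trans sB.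
move=> [S [cS /indsetsP[SB indS]]]; right; exists (x |: S); split.
  rewrite cardsU1 cS; suff -> : x \notin S by [].
  by apply/negP => /(subsetP SB); rewrite !inE eqxx andbF.
apply/indsetsP; split; first by rewrite subUset sx (subset_trans SB).
have xS y : y \in S -> ~~ e x y by move=> /(subsetP SB); rewrite inE => /and3P[].
move=> y z /setU1P[->|yS] /setU1P[->|zS]; rewrite ?e_irr //; [exact: xS| |exact: indS].
by rewrite e_sym; apply: xS.
Qed.

(** Double counting: every R-subset contains an independent a-set, and an a-set lies in
    ['C(#|X| - a, R - a)] of them. *)
Lemma indsets_cover_count a R X :
  (forall Y, Y \subset X -> #|Y| = R -> exists S, [/\ S \subset Y, #|S| = a & S \in indsets X e]) ->
  'C(#|X|, R) <= #|[set S in indsets X e | #|S| == a]| * 'C(#|X| - a, R - a).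
Proof.
move=> cov; set I := [set S in _ | _].
rewrite -cards_draws; set Dr := [set _ | _].
apply: leq_trans (_ : #|\bigcup_(S in I) [set Y in Dr | S \subset Y]| <= _).
  apply/subset_leq_card/subsetP => Y; rewrite inE => /andP[YX /eqP cY].
  have [S [SY cS SI]] := cov Y YX cY; apply/bigcupP; exists S.
    by rewrite in_set SI cS eqxx.
  by rewrite !inE YX cY eqxx.
apply: leq_trans (leq_card_bigcup _ _) _.
rewrite -sum_nat_const; apply: leq_sum => S; rewrite inE => /andP[/indsetsP[SX _] /eqP cS].
have -> : #|X| - a = #|X :\: S| by rewrite cardsD (setIidPr SX) cS.
rewrite -cards_draws -(card_in_imset (f := fun Y => Y :\: S)).
  apply/subset_leq_card/subsetP => _ /imsetP[Y + ->]; rewrite !inE => /andP[/andP[YX /eqP cY] SY].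
  by rewrite setSD //= cardsD (setIidPr SY) cY cS.
move=> Y Z; rewrite !inE => /andP[_ SY] /andP[_ SZ] E.
by rewrite -(setID Y S) -(setID Z S) E (setIidPr SY) (setIidPr SZ).
Qed.

(** The quotient of the binomials is a product of a factors (h - i)/(R - i), each at least h / R.
    With [indsets_cover_count] this gives at least (h / R)^a independent a-sets. *)
Lemma bin_ratio a R h : a <= R -> R <= h ->
  h ^ a * 'C(h - a, R - a) <= 'C(h, R) * R ^ a.
Proof.
move=> + Rh; elim: a => [|a IH] aR; first by rewrite !expn0 !subn0 mul1n muln1.
have {}IH := IH (ltnW aR).
have E : (R - a) * 'C(h - a, R - a) = (h - a) * 'C(h - a.+1, R - a.+1).
  have -> : R - a = (R - a.+1).+1 by lia.
  have -> : h - a = (h - a.+1).+1 by lia.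
  by rewrite -mul_bin_diag.
have Ra : 0 < R - a by lia.
rewrite -(leq_pmul2l Ra) !expnS.
set b := 'C(h - a.+1, R - a.+1) in E *; set c := 'C(h - a, R - a) in E IH.
have h1 : (R - a) * h <= (h - a) * R by nia.
apply: leq_trans (_ : ((h - a) * R) * (h ^ a * b) <= _).
  by rewrite (_ : _ * _ = ((R - a) * h) * (h ^ a * b)); [rewrite leq_mul2r h1 orbT|ring].
rewrite (_ : _ * _ * _ = R * (h ^ a * ((h - a) * b))); last by ring.
rewrite -E (_ : R * _ = (R * (R - a)) * (h ^ a * c)); last by ring.
rewrite (_ : (R - a) * _ = (R * (R - a)) * ('C(h, R) * R ^ a)); last by ring.
by rewrite leq_mul2l IH orbT.
Qed.

Lemma card_small_indsets X r :
  #|[set S in indsets X e | #|S| <= r]| <= \sum_(j < r.+1) 'C(#|X|, j).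
Proof.
apply: leq_trans (_ : #|\bigcup_(j : 'I_r.+1) [set S : {set V} | S \subset X & #|S| == j]| <= _).
  apply/subset_leq_card/subsetP => S; rewrite inE => /andP[/indsetsP[SX _] Sr].
  apply/bigcupP; exists (inord #|S|) => //; by rewrite inE SX inordK ?ltnS ?eqxx.
apply: leq_trans (leq_card_bigcup _ _) _.
by apply: leq_sum => j _; rewrite cards_draws.
Qed.

Lemma sum_bin_le h r : 2 <= h -> \sum_(j < r.+1) 'C(h, j) <= 2 * h ^ r.
Proof.
move=> h2; elim: r => [|r IH]; first by rewrite big_ord1 bin0.
rewrite big_ord_recr /= mulSn mul1n; apply: leq_add.
  by apply: leq_trans IH _; rewrite expnS leq_mul2r h2 orbT.
apply: leq_trans (_ : h ^_ r.+1 <= _).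
  by rewrite -bin_ffact; apply: leq_pmulr; apply: fact_gt0.
elim: r.+1 => // k IHk; rewrite ffactnSr expnSr; apply: leq_mul => //; exact: leq_subr.
Qed.

Lemma card_indsets_le X : #|indsets X e| <= 2 ^ #|X|.
Proof.
rewrite -card_powerset; apply/subset_leq_card/subsetP => S /indsetsP[SX _].
by rewrite inE.
Qed.

Lemma small_to_big X r : 2 * #|[set S in indsets X e | #|S| <= r]| <= #|indsets X e| ->
  #|indsets X e| <= 2 * #|[set S in indsets X e | r.+1 <= #|S|]|.
Proof.
set I := indsets X e; move=> h.
have := cardsID [set S : {set V} | #|S| <= r] I.
have -> : I :&: [set S : {set V} | #|S| <= r] = [set S in I | #|S| <= r].
  by apply/setP => S; rewrite in_setI !in_set.
have -> : I :\: [set S : {set V} | #|S| <= r] = [set S in I | r < #|S|].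
  by apply/setP => S; rewrite in_setD !in_set -ltnNge andbC.
move: h; move: #|[set S in I | #|S| <= r]| #|[set S in I | r < #|S|]| #|I| => a b c; lia.
Qed.

(** Let h = |X|. If h < R^2, the at most 2 h^r small sets are at most half of all by the bound on R.
    Otherwise there are at least (h / R)^(2 r + 2) >= h^(r + 1) independent sets of size 2 r + 2, at
    least twice the number of small sets as h >= 4. Doubling the size r + 1 is what absorbs R. *)
Lemma large_indsets_ramsey X r R : 16 <= #|indsets X e| ->
  (forall Y, Y \subset X -> #|Y| = R ->
     exists S, [/\ S \subset Y, #|S| = 2 * r.+1 & S \in indsets X e]) ->
  4 * R ^ (2 * r) <= #|indsets X e| ->
  #|indsets X e| <= 2 * #|[set S in indsets X e | r.+1 <= #|S|]|.
Proof.
move=> I16 cov RI; apply: small_to_big; set I := #|indsets X e| in I16 RI *.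
set h := #|X|.
have h4 : 4 <= h.
  rewrite leqNgt; apply/negP => h4.
  have : I <= 2 ^ 3 by apply: leq_trans (card_indsets_le X) _; rewrite leq_exp2l.
  lia.
have small : #|[set S in indsets X e | #|S| <= r]| <= 2 * h ^ r.
  by apply: leq_trans (card_small_indsets X r) _; apply: sum_bin_le; lia.
case: (leqP (R ^ 2) h) => hR; last first.
  have : h ^ r <= R ^ (2 * r) by rewrite expnM leq_expl // ltnW.
  lia.
have Rh : R <= h.
  apply: leq_trans hR; case: (R) => // k; rewrite expnS expn1; exact: leq_pmulr.
have [Y YX cY] := subset_of_card Rh.
have [S [SY cS _]] := cov Y YX cY.
have aR : 2 * r.+1 <= R by rewrite -cS -cY; apply: subset_leq_card.
have c1 := indsets_cover_count cov; have c2 := bin_ratio aR Rh.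
set Ia := #|[set S in indsets X e | #|S| == 2 * r.+1]| in c1.
have IaI : Ia <= I.
  by apply/subset_leq_card/subsetP => Z; rewrite inE => /andP[].
have b0 : 0 < 'C(h - 2 * r.+1, R - 2 * r.+1) by rewrite bin_gt0 leq_sub2r.
have c3 : h ^ (2 * r.+1) <= Ia * R ^ (2 * r.+1).
  rewrite -(leq_pmul2r b0); apply: leq_trans c2 _.
  by rewrite -mulnA [X in _ <= _ * X]mulnC mulnA leq_mul2r c1 orbT.
have c4 : h ^ r.+1 <= Ia.
  have hp : 0 < h ^ r.+1 by rewrite expn_gt0; lia.
  rewrite -(leq_pmul2r hp) -expnD addnn -mul2n; apply: leq_trans c3 _.
  by rewrite leq_mul2l expnM leq_exp2r // hR orbT.
have : 4 * h ^ r <= h ^ r.+1 by rewrite expnS leq_mul2r h4 orbT.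
lia.
Qed.

End IndependentSets.

End RamseyCounting.

(** * The occupancy dichotomy from clique and chromatic numbers *)

Section OccupancyBounds.
Local Open Scope nat_scope.

Lemma bin_le_expr p q : 'C(p + q, p) <= q.+1 ^ p.
Proof.
elim: p => [|p IH]; first by rewrite bin0.
rewrite -(leq_pmul2l (ltn0Sn p)) -mul_bin_diag addSn /= expnS.
apply: leq_trans (_ : (p + q).+1 * q.+1 ^ p <= _); first by rewrite leq_mul2l IH orbT.
rewrite mulnA leq_mul2r; apply/orP; right; nia.
Qed.

Lemma bin_le_expl p q : 'C(p + q, p) <= p.+1 ^ q.
Proof.
have := bin_le_expr q p; rewrite addnC -(bin_sub (leq_addl p q)) addnK; exact.
Qed.

(** Here (1 + 1/(8 c))^(4 c) <= 2, by Bernoulli for the inverse 1 - 1/(8 c + 1); the a-th power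
    covers the exponent 4 h since h <= c a. *)
Lemma expn_succ_mul c a h : h <= c * a -> 
  (8 * c).+1 ^ (4 * h) <= 2 ^ a * (8 * c) ^ (4 * h).
Proof.
case: c => [|c]; first by rewrite mul0n leqn0 => /eqP->; rewrite !expn0 muln1 expn_gt0.
set B := 8 * c.+1 => hca.
have base : B.+1 ^ (4 * c.+1) <= 2 * B ^ (4 * c.+1).
  rewrite -(ler_nat rat) natrM !natrX.
  have B0 : (0 < B%:R :> rat)%R by rewrite ltr0n.
  have B1 : (0 < B.+1%:R :> rat)%R by rewrite ltr0n.
  have E : (B%:R = B.+1%:R * (1 - B.+1%:R^-1) :> rat)%R.
    by rewrite mulrBr mulr1 divff ?gt_eqF // -natr1 addrK.
  rewrite E exprMn mulrCA ler_peMr ?exprn_ge0 //.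
  have x1 : (B.+1%:R^-1 <= 1 :> rat)%R by rewrite invf_le1 // ler1n.
  have := @bernoulli rat (- B.+1%:R^-1)%R (4 * c.+1); rewrite lerN2 => /(_ x1).
  have : ((4 * c.+1)%:R * B.+1%:R^-1 <= 1 / 2 :> rat)%R.
    by rewrite ler_pdivrMr // (_ : B.+1%:R = 2 * (4 * c.+1)%:R + 1 :> rat)%R;
      [lra|rewrite -natr1 /B !natrM; ring].
  rewrite mulrN; set x := (_^-1)%R; set y := (_ * x)%R; set z := (_ ^+ _)%R; lra.
have full : B.+1 ^ (4 * (c.+1 * a)) <= 2 ^ a * B ^ (4 * (c.+1 * a)).
  by rewrite !mulnA expnM [B ^ _]expnM -expnMn; apply: leq_expl.
have le4 : 4 * h <= 4 * (c.+1 * a) by rewrite leq_mul2l.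
have p0 : 0 < B ^ (4 * (c.+1 * a) - 4 * h) by rewrite expn_gt0.
rewrite -(leq_pmul2r p0) -[leqRHS]mulnA -expnD subnKC //.
apply: leq_trans full; rewrite -{2}(subnKC le4) expnD leq_mul2l leq_expl ?orbT //.
Qed.

(** Insert the weight b^(r - j) >= 1 and complete the sum to the binomial expansion of (b + 1)^h. *)
Lemma sum_bin_weighted b h r : 0 < b ->
  b ^ h * \sum_(j < r.+1) 'C(h, j) <= b ^ r * b.+1 ^ h.
Proof.
move=> b0; rewrite -[b.+1]addn1 expnDn !big_distrr /=.
have E n : n.+1 <= h.+1 -> \sum_(j < n.+1) b ^ r * ('C(h, j) * (b ^ (h - j) * 1 ^ j)) <=
   \sum_(i < h.+1) b ^ r * ('C(h, i) * (b ^ (h - i) * 1 ^ i)).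
  move=> nh; rewrite -!(big_mkord xpredT (fun j => b ^ r * ('C(h, j) * (b ^ (h - j) * 1 ^ j)))).
  by rewrite [leqRHS](big_cat_nat _ nh) //= leq_addr.
have F n : n <= h -> n <= r -> \sum_(j < n.+1) b ^ h * 'C(h, j) <=
    \sum_(j < n.+1) b ^ r * ('C(h, j) * (b ^ (h - j) * 1 ^ j)).
  move=> nh nr; apply: leq_sum => j _; rewrite exp1n muln1 mulnCA mulnC leq_mul2l -expnD.
  apply/orP; right; rewrite leq_pexp2l //; have := ltn_ord j; lia.
case: (leqP r h) => rh; first by apply: leq_trans (F r rh (leqnn r)) (E r _).
apply: leq_trans (leq_trans (F h (leqnn h) (ltnW rh)) (E h (leqnn _))).
rewrite -!(big_mkord xpredT (fun j => b ^ h * 'C(h, j))).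
rewrite (@big_cat_nat _ _ _ h.+1) //=; last by lia.
rewrite (_ : \sum_(h.+1 <= j < r.+1) _ = 0) ?addn0 // big_nat_cond big1 //.
by move=> j /andP[/andP[hj _] _]; rewrite bin_small ?muln0.
Qed.

Section Colored.
Variables (V : finType) (e : rel V) (X : {set V}) (c : nat) (col : V -> nat).
Hypothesis col_lt : forall x, x \in X -> col x < c.
Hypothesis col_proper : forall x y, x \in X -> y \in X -> e x y -> col x != col y.

(** A largest color class has at least |X| / c vertices, and all its subsets are independent. *)
Lemma large_color_class : exists2 a, #|X| <= c * a & 2 ^ a <= #|indsets X e|.
Proof.
have [X0|[x xX]] := set_0Vmem X.
  exists 0; first by rewrite X0 cards0.
  rewrite expn0 card_gt0; apply/set0Pn; exists set0; apply/indsetsP.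
  by split; [apply: sub0set|move=> x y; rewrite inE].
have c0 : 0 < c by apply: leq_ltn_trans (col_lt xX).
pose cl (i : 'I_c) := [set y in X | col y == i].
have [i _ imax] := @arg_maxnP _ (Ordinal c0) xpredT (fun i => #|cl i|) isT.
exists #|cl i|.
  apply: leq_trans (_ : \sum_(j < c) #|cl j| <= _).
    apply: leq_trans (leq_card_bigcup _ _); apply/subset_leq_card/subsetP => y yX.
    by apply/bigcupP; exists (Ordinal (col_lt yX)); rewrite // inE yX /=.
  apply: leq_trans (_ : \sum_(j < c) #|cl i| <= _).
    by apply: leq_sum => j _; apply: imax.
  by rewrite sum_nat_const card_ord.
rewrite -card_powerset; apply/subset_leq_card/subsetP => S; rewrite inE => Scl.
apply/indsetsP; split.
  by apply: subset_trans Scl _; apply/subsetP => y; rewrite inE => /andP[].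
move=> y z /(subsetP Scl) + /(subsetP Scl); rewrite !inE => /andP[yX /eqP yi] /andP[zX /eqP zi].
by apply/negP => /(col_proper yX zX); rewrite yi zi eqxx.
Qed.

(* There are at most (8c)^r (1 + 1/(8c))^h sets of size at most r in X, where
   h = |X|, and a color class of size at least h / c makes (1 + 1/(8c))^(4h) at
   most |indsets X e|. *)
Lemma large_indsets_colored r d : 0 < c -> (c + 1) ^ (32 * r) <= d ->
  d < #|indsets X e| ^ 7 -> 2 ^ 11 <= #|indsets X e| ->
  #|indsets X e| <= 2 * #|[set S in indsets X e | r.+1 <= #|S|]|.
Proof.
move=> c0 cd dI I11; apply: small_to_big.
set N := #|[set S in _ | _]|; set I := #|indsets X e| in dI I11 *.
have [a Xa aI] := large_color_class; rewrite -/I in aI.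
set h := #|X| in Xa.
set B := 8 * c; have B0 : 0 < B by rewrite muln_gt0.
have N4 : N ^ 4 <= B ^ (4 * r) * I.
  have p0 : 0 < B ^ (4 * h) by rewrite expn_gt0 B0.
  rewrite -(leq_pmul2l p0).
  apply: leq_trans (_ : (B ^ r * B.+1 ^ h) ^ 4 <= _).
    rewrite [4 * h]mulnC expnM -expnMn; apply: leq_expl.
    apply: leq_trans (sum_bin_weighted _ _ B0); rewrite leq_mul2l.
    by rewrite card_small_indsets orbT.
  rewrite expnMn -!expnM ![_ * 4]mulnC.
  apply: leq_trans (_ : B ^ (4 * r) * (2 ^ a * B ^ (4 * h)) <= _).
    by rewrite leq_mul2l expn_succ_mul // orbT.
  rewrite [leqRHS]mulnCA leq_mul2l; apply/orP; right.
  by rewrite mulnC leq_mul2l aI orbT.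
have B3 : B <= (c + 1) ^ 3.
  by rewrite /B !expnS expn0; nia.
(* With B <= (c + 1)^3, N^32 is at most ((c + 1)^(32 r))^3 I^8 <= d^3 I^8 <= I^29; the remaining I^3
   >= 2^33 absorbs the factor 2^32. *)
have N32 : N ^ 32 <= I ^ 29.
  apply: leq_trans (_ : (B ^ (4 * r) * I) ^ 8 <= _).
    by rewrite (_ : 32 = 4 * 8) // expnM leq_expl.
  apply: leq_trans (_ : (((c + 1) ^ 3) ^ (4 * r) * I) ^ 8 <= _).
    by rewrite leq_expl // leq_mul2r leq_expl ?orbT.
  have E : (((c + 1) ^ 3) ^ (4 * r)) ^ 8 = ((c + 1) ^ (32 * r)) ^ 3.
    by rewrite -!expnM; congr (_ ^ _); lia.
  rewrite expnMn E [leqRHS](expnD _ 21 8) leq_mul2r (expnM _ 7 3); apply/orP; right.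
  by apply: leq_expl; apply: ltnW; apply: leq_ltn_trans dI.
rewrite -(@leq_exp2r _ _ 32) // expnMn.
apply: leq_trans (_ : (2 ^ 11) ^ 3 * I ^ 29 <= _).
  apply: leq_mul; last exact: N32.
  rewrite -expnM (leq_exp2l 32 (11 * 3)); exact: isT.
by rewrite [leqRHS](expnD _ 3 29) leq_mul2r leq_expl ?orbT.
Qed.
End Colored.

Section Occupancy.
Variables (G : sgraph) (v : G).

Lemma clique_in_nbhd (K : {set G}) : K \subset nbhd v -> clique K -> #|K| < omega v.
Proof.
move=> Kv clK; have vK : v \notin K.
  by apply/negP => /(subsetP Kv); rewrite inE edge_irr.
rewrite (_ : #|K|.+1 = #|v |: K|); last by rewrite cardsU1 vK.
apply: leq_bigmax_cond; rewrite setU11 andbT; apply/forall_inP => x xK; apply/forall_inP => y yK.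
have vE z : z \in K -> edge v z by move=> /(subsetP Kv); rewrite inE.
apply/implyP; case/setU1P: xK => [->|xK]; case/setU1P: yK => [->|yK]; rewrite ?eqxx // => xy.
- exact: vE.
- by rewrite edge_sym; apply: vE.
- by move/forall_inP/(_ x xK)/forall_inP/(_ y yK)/implyP: clK; apply.
Qed.

Lemma nbhd_coloring : exists col : G -> nat,
  (forall x, x \in nbhd v -> col x < chi v) /\
  (forall x y, x \in nbhd v -> y \in nbhd v -> edge x y -> col x != col y).
Proof.
rewrite /chi /chromatic_number; case: ex_minnP => k /existsP[c /forallP cP] _.
exists (fun x => oapp (fun y : induced (nbhd v) => nat_of_ord (c y)) 0 (insub x)); split.
  by move=> x xv; rewrite insubT /=; apply: ltn_ord.
move=> x y xv yv xy; rewrite !insubT /=.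
have /forallP/(_ (Sub y yv : induced (nbhd v)))/implyP := cP (Sub x xv).
by apply.
Qed.

(** Beyond T the number of independent sets exceeds the seventh root of d, and each case brings the
    requirement of one counting lemma below it. The two omega cases bound the Ramsey binomial by (p
    + 1)^q and by (q + 1)^p, with p + 1 = omega v and q = 2 r + 1. *)
Lemma occupancy_from_power (T d r : nat) : 2 ^ 11 <= T ->
  (forall i, T < i -> d < i ^ 7) -> 0 < chi v ->
  [\/ omega v ^ (576 * (r * r)) <= d,
      (2 * r.+1) ^ (24 * (r * omega v)) <= d |
      (chi v + 1) ^ (32 * r) <= d] -> occupancy v T r.+1.
Proof.
move=> T11 dT chi0 cases X e Xv e_sym e_edge.
case: (leqP #|indsets X e| T) => [|TI]; [by left|right].
have dI := dT _ TI; have I11 := leq_trans T11 (ltnW TI).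
have e_irr : irreflexive e by move=> x; apply/negbTE/negP => /e_edge; rewrite edge_irr.
have I16 : 16 <= #|indsets X e| by exact: leq_trans (isT : 16 <= 2 ^ 11) I11.
(* Ramsey must give the independent set: a clique of omega v vertices in the neighborhood would
   extend by v. *)
have ram p q R (Y : {set G}) : omega v = p.+1 -> 'C(p + q, p) <= R -> Y \subset X -> #|Y| = R ->
    exists S : {set G}, [/\ S \subset Y, #|S| = q.+1 & S \in indsets X e].
  move=> wp binR YX cY; rewrite -cY in binR.
  case: (ramsey e_sym e_irr binR) => [[K [KY cK clK]]|[S [cS /indsetsP[SY Sind]]]].
    have : #|K| < omega v.
      apply: clique_in_nbhd; first by apply: subset_trans KY (subset_trans YX Xv).
      apply/forall_inP => x xK; apply/forall_inP => y yK; apply/implyP => xy.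
      exact/e_edge/clK.
    by rewrite cK wp ltnn.
  exists S; split=> //; apply/indsetsP; split=> //; exact: subset_trans SY YX.
have [p wp] : exists p, omega v = p.+1.
  have w0 : 0 < omega v.
    apply: leq_ltn_trans (@clique_in_nbhd set0 _ _) => //; first exact: sub0set.
    by apply/forall_inP => x; rewrite inE.
  by exists (omega v).-1; rewrite prednK.
set I := #|indsets X e| in dI I11 I16 TI *.
have I4 : 4 <= I by apply: leq_trans I16.
have below x k j : 0 < x -> 7 * k <= j -> x ^ j <= d -> x ^ k < I.
  move=> x0 kj xd; rewrite -(@ltn_exp2r _ _ 7) //; apply: leq_ltn_trans dI.
  by apply: leq_trans xd; rewrite -expnM leq_pexp2l // mulnC.
have w0 : 0 < omega v by rewrite wp.
case: cases => [c1|c2|c3].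
- apply: (@large_indsets_ramsey _ e X r (omega v ^ (2 * r).+1)) => // [Y YX cY|].
    have [|S [SY cS SI]] := ram p (2 * r).+1 _ Y wp _ YX cY.
      by rewrite wp; apply: bin_le_expl.
    by exists S; split=> //; rewrite cS mulnS.
  rewrite -/I -expnM.
  case: (posnP r) => [->|r0]; first by rewrite !muln0 expn0.
  case: p wp => [|p] wp; first by rewrite wp exp1n.
  apply: ltnW; apply: (leq_ltn_trans _ (below _ (8 * (r * r)) _ w0 _ c1)); last by lia.
  apply: leq_trans (_ : omega v ^ 2 * omega v ^ ((2 * r).+1 * (2 * r)) <= _).
    by rewrite leq_mul2r (@leq_expl 2 _ 2) ?orbT // wp.
  by rewrite -expnD leq_pexp2l //; nia.
- apply: (@large_indsets_ramsey _ e X r ((2 * r.+1) ^ p)) => // [Y YX cY|].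
    have [|S [SY cS SI]] := ram p (2 * r).+1 _ Y wp _ YX cY.
      by rewrite mulnS; apply: bin_le_expr.
    by exists S; split=> //; rewrite cS mulnS.
  rewrite -/I -expnM.
  case: (posnP r) => [->|r0]; first by rewrite !muln0 expn0.
  apply: ltnW; apply: (leq_ltn_trans _ (below _ (2 * (r * omega v)) _ _ _ c2)) => //; last by lia.
  apply: leq_trans (_ : (2 * r.+1) ^ 1 * (2 * r.+1) ^ (p * (2 * r)) <= _).
    by rewrite leq_mul2r expn1 (_ : 4 <= 2 * r.+1) ?orbT //; lia.
  by rewrite -expnD leq_pexp2l // wp; nia.
- have [col [col_lt col_ne]] := nbhd_coloring.
  apply: (@large_indsets_colored _ e X (chi v) col _ _ r d) => //.
    by move=> x /(subsetP Xv); apply: col_lt.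
  by move=> x y /(subsetP Xv) xv /(subsetP Xv) yv /e_edge; apply: col_ne.
Qed.
End Occupancy.

End OccupancyBounds.

(** * Choice of parameters *)

Section ExponentChoice.
Local Open Scope nat_scope.

Lemma ex_root70 d : exists t, d <= t ^ 70.
Proof. by exists d; case: d => // d; rewrite -{1}(expn1 d.+1) leq_pexp2l. Qed.

(** Parameters are powers of this integer root t, which avoids real exponents. As 70 is divisible by
    2 and 7, t^35 and t^10 serve as square root and seventh root of the degree, up to rounding. *)
Definition root70 d := ex_minn (ex_root70 d).

Lemma root70_ge d : d <= root70 d ^ 70.
Proof. by rewrite /root70; case: ex_minnP. Qed.

Lemma root70_min d t : d <= t ^ 70 -> root70 d <= t.
Proof. by rewrite /root70; case: ex_minnP => s _ h /h. Qed.

Lemma leq_root70 d d' : d <= d' -> root70 d <= root70 d'.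
Proof. by move=> dd; apply: root70_min; apply: leq_trans (root70_ge d'). Qed.

Lemma root70_gt d t : t ^ 70 < d -> t < root70 d.
Proof.
move=> td; rewrite ltnNge; apply/negP => le; move: td; rewrite ltnNge => /negP; apply.
by apply: leq_trans (root70_ge d) _; apply: leq_expl.
Qed.

(** Rounding up costs at most a factor 2, as (1 - 1/t)^70 >= 1/2 for t >= 140 by Bernoulli. *)
Lemma root70_le d : 140 <= root70 d -> root70 d ^ 70 <= 2 * d.
Proof.
move=> t140; set t := root70 d in t140 *.
have lt : t.-1 ^ 70 < d.
  rewrite ltnNge; apply/negP => /root70_min; rewrite -/t; lia.
apply: leq_trans (_ : 2 * t.-1 ^ 70 <= _); last by rewrite leq_mul2l ltnW.
rewrite -(ler_nat rat) natrM !natrX.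
have t0 : (0 < t%:R :> rat)%R by rewrite ltr0n; lia.
have E : (t.-1%:R = t%:R * (1 - t%:R^-1) :> rat)%R.
  rewrite mulrBr mulr1 divff ?gt_eqF //.
  have t1 : t.-1.+1 = t by lia.
  have : (t.-1%:R + 1 = t%:R :> rat)%R by rewrite natr1 t1.
  lra.
rewrite E exprMn mulrCA ler_peMr ?exprn_ge0 //.
have x1 : (t%:R^-1 <= 1 :> rat)%R by rewrite invf_le1 // ler1n; lia.
have := @bernoulli rat (- t%:R^-1)%R 70; rewrite lerN2 => /(_ x1).
have : (70 * t%:R^-1 <= 1 / 2 :> rat)%R.
  rewrite (ler_pdivrMr _ _ t0).
  have : (140 <= t%:R :> rat)%R by rewrite (ler_nat _ 140).
  lra.
rewrite mulrN; set y := (_ ^+ _)%R; lra.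
Qed.

Definition loglog d := trunc_log 2 (trunc_log 2 d).

Lemma leq_loglog d d' : d <= d' -> loglog d <= loglog d'.
Proof. by move=> dd; apply/leq_trunc_log/leq_trunc_log. Qed.

(** [loglog] is the level of a vertex; equal levels j put both integer logarithms between 2^j and
    2^(j + 1). *)
Lemma loglog_eq_sqr d d' : 1 < d -> loglog d = loglog d' -> d' <= d ^ 2.
Proof.
move=> d1 E; case: (posnP d') => [->//|d0].
have l1 : 0 < trunc_log 2 d by rewrite trunc_log_gt0.
have h1 : 2 ^ loglog d <= trunc_log 2 d by rewrite trunc_logP.
have h2 : trunc_log 2 d' < 2 ^ (loglog d').+1 by rewrite trunc_log_ltn.
apply: leq_trans (ltnW (trunc_log_ltn d' (isT : 1 < 2))) _.
apply: leq_trans (_ : 2 ^ (2 * trunc_log 2 d) <= _).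
  by rewrite leq_exp2l // (leq_trans h2) // -E expnS leq_mul2l h1.
by rewrite mulnC expnM leq_exp2r // trunc_logP // ltnW.
Qed.

Section FixedGraph.
Variables (G : sgraph) (C : finType) (L : G -> {set C}).
Variable cf : G -> C -> G -> C -> bool.
Hypothesis cf_edge : forall u a v b, cf u a v b -> edge u v.
Hypothesis cf_sym : forall u a v b, cf u a v b = cf v b u a.
Hypothesis cf_inj : forall u a v b b', cf u a v b -> cf u a v b' -> b = b'.
Variables (D B : nat) (r : G -> nat).
Local Notation t v := (root70 (deg v)).
Hypothesis deg_le : forall v : G, deg v <= D.
Hypothesis D_lt : D < 2 ^ B.
Hypothesis B_ge : 4 <= B.
Hypothesis B_le : forall v : G, B <= 3 * t v ^ 35.
Hypothesis t_ge : forall v : G, 2 ^ 11 <= t v.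
Hypothesis L_le : forall v, #|L v| <= 3 * deg v.
Hypothesis L_ge : forall v, 28 * t v ^ 69 <= #|L v|.
Hypothesis r_ge : forall v, 3 * deg v <= #|L v| * (r v).+1.
Hypothesis r_le : forall v,
  [\/ omega v ^ (576 * (r v * r v)) <= deg v,
      (2 * (r v).+1) ^ (24 * (r v * omega v)) <= deg v |
      (chi v + 1) ^ (32 * r v) <= deg v].

(* With t^70 ~ deg v, the first phase uses T = t^10 and leaves lists of size
   l = t^59 with conflict degrees at most M = O(B t^11). As B = O(t^35), the bound
   M w is o(l) at v as soon as deg w is at most the square of deg v. *)
Lemma coloring_from_parameters :
  exists phi : G -> C, forall u, phi u \in L u /\ forall v, ~~ cf u (phi u) v (phi v).
Proof.
(* The local lemma asks for 8 (D^2 + D^3) <= 2^m, and D^3 <= 2^(3 B). *)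
pose m := 3 * B + 4.
have t0 (v : G) : 0 < t v by apply: leq_trans (t_ge v); rewrite expn_gt0.
have m4 : m <= 4 * B by rewrite /m; lia.
have mt (v : G) : m <= 12 * t v ^ 35.
  by apply: leq_trans m4 _; have := B_le v; lia.
(* An extra power of t absorbs any constant up to 2^11. *)
have gap (v : G) c a b : c <= 2 ^ 11 -> 0 < a -> c * t v ^ b <= t v ^ (a + b).
  move=> ca a0; rewrite expnD leq_mul2r; apply/orP; right.
  apply: leq_trans ca (leq_trans (t_ge v) _).
  by rewrite -{1}(expn1 (t v)) leq_pexp2l.
have d0 (v : G) : 2 ^ 11 <= deg v.
  rewrite leqNgt; apply/negP => lt; have := t_ge v; apply/negP; rewrite -ltnNge.
  apply: leq_ltn_trans (_ : 2 < 2 ^ 11); last by rewrite (ltn_exp2l 1 11).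
  apply: root70_min; apply: leq_trans (ltnW lt) _; by rewrite leq_exp2l.
have d0' (v : G) : 0 < deg v by apply: leq_trans (d0 v); rewrite expn_gt0.
have t70 (v : G) : t v ^ 70 <= 2 * deg v.
  by apply: root70_le; apply: leq_trans (t_ge v).
pose J := (trunc_log 2 B).+1.
have Jt (v : G) : J <= t v ^ 2.
  have h : 2 ^ trunc_log 2 B < 2 ^ (2 + 35 * t v).
    apply: leq_ltn_trans (_ : B < _); first by rewrite trunc_logP //; lia.
    apply: leq_ltn_trans (B_le v) _; rewrite expnD mulnC [_ * t v]mulnC expnM.
    apply: leq_ltn_trans (_ : t v ^ 35 * 4 < _); first by rewrite leq_mul2l orbT.
    by rewrite mulnC ltn_mul2l /= ltn_exp2r // ltn_expl.
  rewrite ltn_exp2l // in h.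
  apply: leq_trans h _; apply: leq_trans (_ : 37 * t v ^ 1 <= _); last first.
    exact: (gap v 37 1 1 isT isT).
  rewrite expn1; have := t0 v; lia.
(* As |L v| <= 3 deg v, the bound on addable pairs is at most 6 m deg v, and deg v <= t^11 t^59. *)
pose M (v : G) := 6 * (m * t v ^ 11).
(* Makes 2^s equal to 8 * 2^B * 2^(8 M), which meets the loss condition as D < 2^B. *)
pose s (v : G) := 8 * M v + B + 3.
have tt (v w : G) : loglog (deg v) = loglog (deg w) -> t w <= 2 * t v ^ 2.
  move=> E; rewrite -(@leq_exp2r _ _ 70) //; apply: leq_trans (t70 w) _.
  have h : deg w <= deg v ^ 2.
    by apply: loglog_eq_sqr E; apply: leq_trans (d0 v); rewrite (ltn_exp2l 0 11).
  rewrite expnMn; apply: leq_mul; first by rewrite -{1}(expn1 2) leq_exp2l.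
  apply: leq_trans h _; rewrite -expnM mulnC expnM leq_exp2r //; exact: root70_ge.
apply: (@two_phase_coloring G C L cf cf_edge cf_sym cf_inj D m J
  (fun v : G => t v ^ 10) (fun v : G => (r v).+1) (fun v : G => t v ^ 59) M s
  (fun v : G => loglog (deg v))).
- by move=> v; rewrite d0' deg_le.
- have D3 : D ^ 3 <= 2 ^ (3 * B) by rewrite mulnC expnM leq_expl // ltnW.
  have D2 : D ^ 2 <= 2 ^ (3 * B).
    apply: leq_trans D3; case: (D) => // k; by rewrite leq_pexp2l.
  rewrite /m expnD; set x := 2 ^ (3 * B) in D2 D3 *.
  by rewrite (_ : 2 ^ 4 = 16) //; lia.
- move=> v; split=> //; apply: leq_trans (_ : t v ^ 1 <= _); last by rewrite leq_pexp2l.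
  by rewrite expn1; apply: leq_trans (t_ge v); rewrite (leq_exp2l 1 11).
- move=> v; apply: (@occupancy_from_power G v (t v ^ 10) (deg v)) => //.
  + by apply: leq_trans (t_ge v) _; rewrite -{1}(expn1 (t v)) leq_pexp2l.
  + move=> i ti; apply: leq_ltn_trans (root70_ge (deg v)) _.
    by rewrite (expnM _ 10 7) ltn_exp2r.
  + have [col [col_lt _]] := nbhd_coloring v.
    have /card_gt0P[u uv] : 0 < #|nbhd v| by apply: d0'.
    exact: leq_ltn_trans (col_lt u uv).
- exact: r_ge.
- move=> v; apply: leq_trans (L_ge v).
  (* Then 4 T (3 m + 6 l) <= 28 T l, whence the constant in [L_ge]. *)
  have h : 3 * m <= t v ^ 59.
    apply: leq_trans (_ : 36 * t v ^ 35 <= _); first by have := mt v; lia.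
    exact: (gap v 36 24 35 isT isT).
  rewrite (expnD _ 10 59) -mulnA mulnCA; move: (t v ^ 10) (t v ^ 59) h => x y h; nia.
- move=> v; have aux k d x n : 2 <= n -> d <= x -> k <= 3 * d -> n * (k + d) + 2 * d <= 6 * (n * x).
    by move=> *; nia.
  rewrite /M -mulnA -mulnA -(expnD _ 11 59); apply: aux; [rewrite /m; lia|exact: root70_ge|].
  exact: L_le.
- by move=> v; rewrite expn_gt0 t0.
- move=> v; rewrite ltnS; apply: leq_trunc_log; rewrite -ltnS.
  apply: leq_trans (_ : B < B.+1) => //; rewrite ltnS ltnW //.
  rewrite -(ltn_exp2l _ _ (isT : 1 < 2)); apply: leq_ltn_trans D_lt.
  by apply: leq_trans (deg_le v); rewrite trunc_logP.
- move=> v w E; rewrite /M.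
  apply: leq_trans (_ : 16 * (6 * (12 * t v ^ 35 * (2 * t v ^ 2) ^ 11)) <= _).
    rewrite !leq_mul2l /=; apply: leq_mul; first exact: mt.
    by apply: leq_expl; apply: tt.
  rewrite expnMn -expnM (_ : 16 * _ = 1152 * (2 ^ 11 * (t v ^ 35 * t v ^ 22))); last by ring.
  rewrite -expnD; apply: leq_trans (gap v 1152 1 58 isT isT).
  rewrite leq_mul2l; apply: (gap v _ 1 57 (leqnn _) isT).
- move=> v w lt; apply: leq_expl; apply: leq_root70; apply: ltnW; rewrite ltnNge.
  by apply/negP => /leq_loglog; rewrite leqNgt lt.
- move=> v; have aux x y : D <= y -> 8 * D * x <= x * y * 2 ^ 3.
    by move=> Dy; rewrite (_ : 2 ^ 3 = 8) //; nia.
  by rewrite /s !expnD; apply/aux/ltnW.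
- move=> v; have hs : s v <= 10 * M v.
    have : 2 * m <= M v.
      have aux n x : 0 < x -> 2 * n <= 6 * (n * x) by move=> *; nia.
      by apply: aux; rewrite expn_gt0 t0.
    rewrite /s /m; lia.
  apply: leq_trans (_ : 2 * t v ^ 2 * (10 * (6 * (12 * t v ^ 35 * t v ^ 11))) <= _).
    apply: leq_mul; first by rewrite leq_mul2l Jt orbT.
    apply: leq_trans hs _; rewrite /M !leq_mul2l /= leq_mul2r mt orbT //.
  rewrite (_ : _ * _ = 1440 * (t v ^ 2 * (t v ^ 35 * t v ^ 11))); last by ring.
  rewrite -!expnD; exact: (gap v 1440 11 48 isT isT).
Qed.
End FixedGraph.

End ExponentChoice.

(** * Logarithmic estimates *)

(** Used as ln d <= t for t = [root70 d]. It comes down to 70 (j + 1) <= 2^j for j >= 11, where j is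
    the integer logarithm of t. *)
Lemma expn70_le t : (2 ^ 11 <= t)%N -> (t ^ 70 <= 2 ^ t)%N.
Proof.
move=> t11; pose j := trunc_log 2 t.
have t0 : (0 < t)%N by apply: leq_trans t11; rewrite expn_gt0.
have j11 : (11 <= j)%N by apply: trunc_log_max.
have h1 : (2 ^ j <= t)%N by rewrite trunc_logP.
have h2 : (t < 2 ^ j.+1)%N by rewrite trunc_log_ltn.
apply: (@leq_trans (2 ^ (70 * j.+1))).
  by rewrite mulnC expnM leq_expl // ltnW.
rewrite leq_exp2l //; apply: leq_trans h1; move: j11.
elim: (j) => // i IH; rewrite leq_eqVlt => /orP[/eqP <-//|]; rewrite ltnS => i11.
have := IH i11; rewrite expnS; move: (2 ^ i)%N => x; lia.
Qed.

Section RealBounds.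
Variable R : realType.

(** Both from ln (1 + x) <= x: at x = -1/2, and at x = 3/32 with 2 <= (1 + 3/32)^8. *)
Lemma ln2_bounds : 1 / 2 <= ln (2 : R) <= 3 / 4.
Proof.
have two : (2 : R) \is Num.pos by rewrite posrE.
apply/andP; split.
  have := @le_ln1Dx R (- (1 / 2)); rewrite (_ : 1 + - (1 / 2) = 2^-1 :> R); last by lra.
  rewrite lnV // => h; have : - ln (2 : R) <= - (1 / 2) by apply: h; lra.
  lra.
have : ln (2 : R) <= ln ((1 + 3 / 32) ^+ 8).
  rewrite ler_ln ?posrE //; last by apply: exprn_gt0; lra.
  rewrite (exprM _ 2 4) (exprM _ 2 2); set x : R := (1 + 3 / 32) ^+ 2.
  have x1 : 119 / 100 <= x by rewrite /x expr2; lra.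
  have x2 : 141 / 100 <= x ^+ 2 by rewrite expr2; nra.
  have x4 : 1 / 1 <= x ^+ 2 ^+ 2 by rewrite expr2; nra.
  by rewrite expr2; nra.
rewrite lnXn -?[ln _ *+ 8]mulr_natl; last by lra.
have := @le_ln1Dx R (3 / 32) => h h'.
have : ln (1 + 3 / 32 : R) <= 3 / 32 by apply: h; lra.
lra.
Qed.

Lemma expn_le_of_ln (x n d : nat) : (0 < x)%N -> (0 < d)%N ->
  n%:R * ln (x%:R : R) <= ln d%:R -> (x ^ n <= d)%N.
Proof.
move=> x0 d0 h; rewrite -(ler_nat R) natrX.
have x0' : 0 < x%:R :> R by rewrite ltr0n.
rewrite -ler_ln ?posrE ?exprn_gt0 ?ltr0n //.
by rewrite lnXn // -[ln _ *+ n]mulr_natl.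
Qed.

Lemma ln_nat_ge (n d : nat) : (2 ^ n <= d)%N -> n%:R / 2 <= ln (d%:R : R).
Proof.
move=> h; have d0 : (0 < d)%N by apply: leq_trans h; rewrite expn_gt0.
have /andP[l2 _] := ln2_bounds.
apply: le_trans (_ : ln ((2 ^ n)%:R : R) <= _); last first.
  by rewrite ler_ln ?posrE ?ltr0n ?expn_gt0 // ler_nat.
rewrite natrX lnXn // -[ln _ *+ n]mulr_natl; apply: ler_wpM2l => //; lra.
Qed.

Section Vertex.
Variables (d w c n : nat).
Local Notation ld := (ln (d%:R : R)).
Hypothesis t_ge : (2 ^ 11 <= root70 d)%N.
Hypothesis w_ge : (2 <= w)%N.
Hypothesis c_ge : (1 <= c)%N.
Hypothesis n_ge : d%:R * (72 * Num.min (Num.sqrt (ln w%:R / ld))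
  (Num.min (w%:R * ln ld / ld) (log2 (c%:R + 1) / ld))) <= n%:R.

Lemma vertex_deg_ge : (2 ^ 11 <= d)%N.
Proof.
rewrite leqNgt; apply/negP => lt; have := t_ge; apply/negP; rewrite -ltnNge.
apply: (@leq_ltn_trans 2); last by rewrite (ltn_exp2l 1 11).
by apply: root70_min; apply: leq_trans (ltnW lt) _; rewrite leq_exp2l.
Qed.

Lemma vertex_ln_ge : 4 <= ld.
Proof. by have := ln_nat_ge vertex_deg_ge; lra. Qed.

Lemma vertex_lnln_ge : 1 <= ln ld.
Proof.
have l4 := vertex_ln_ge; have /andP[l2 _] := ln2_bounds.
apply: (@le_trans _ _ (ln ((2 : R) ^+ 2))).
  by rewrite lnXn // -[ln _ *+ 2]mulr_natl; lra.
by rewrite ler_ln ?posrE ?exprn_gt0 // ?expr2; lra.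
Qed.

(** Gives n >= 72 d / ln d whichever term is smallest. *)
Lemma vertex_min_ge : 1 / ld <= Num.min (Num.sqrt (ln w%:R / ld))
  (Num.min (w%:R * ln ld / ld) (log2 (c%:R + 1) / ld)).
Proof.
have l4 := vertex_ln_ge; have ll := vertex_lnln_ge; have /andP[l2 _] := ln2_bounds.
have ld0 : 0 < ld by lra.
have w2 : 2 <= w%:R :> R by rewrite (ler_nat R 2).
have c1 : 1 <= c%:R :> R by rewrite (ler_nat R 1).
rewrite !le_min; apply/and3P; split.
- have lw : 1 / 2 <= ln (w%:R : R).
    by apply: le_trans l2 _; rewrite ler_ln ?posrE //; lra.
  rewrite -[leLHS]ger0_norm; last by rewrite divr_ge0 // ltW.
  rewrite -sqrtr_sqr; apply: ler_wsqrtr.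
  rewrite (ler_pdivlMr _ _ ld0) (_ : (1 / ld) ^+ 2 * ld = 1 / ld); last first.
    by field; rewrite gt_eqF.
  apply: le_trans lw; rewrite (ler_pdivrMr _ _ ld0); lra.
- rewrite ler_pM2r ?invr_gt0 //; nra.
- rewrite ler_pM2r ?invr_gt0 // /log2 ler_pdivlMr; last by lra.
  rewrite mul1r ler_ln ?posrE //; lra.
Qed.

(** From 72 d <= n ln d, with ln d <= t and t^70 <= 2 d. *)
Lemma vertex_list_ge : (36 * root70 d ^ 69 <= n)%N.
Proof.
have l4 := vertex_ln_ge; have ld0 : 0 < ld by lra.
have /andP[l2 l2'] := ln2_bounds.
have t11 := t_ge; set t := root70 d in t11 *.
have t0 : (0 < t)%N by apply: leq_trans t11; rewrite expn_gt0.
have d0 : (0 < d)%N by apply: leq_trans vertex_deg_ge; rewrite expn_gt0.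
have ldt : ld <= t%:R.
  apply: le_trans (_ : ln ((2 ^ t)%:R : R) <= _).
    rewrite ler_ln ?posrE ?ltr0n ?expn_gt0 // ler_nat.
    apply: leq_trans (expn70_le t11); exact: root70_ge.
  rewrite natrX lnXn // -[ln _ *+ t]mulr_natl ler_piMr //; lra.
have h : 72 * d%:R <= n%:R * t%:R :> R.
  apply: le_trans (_ : n%:R * ld <= _); last by apply: ler_wpM2l.
  rewrite -(ler_pdivrMr _ _ ld0); apply: le_trans n_ge.
  rewrite (_ : 72 * d%:R / ld = d%:R * (72 * (1 / ld))); last by ring.
  by apply: ler_wpM2l => //; apply: ler_wpM2l => //; apply: vertex_min_ge.
have {h} h : (72 * d <= n * t)%N by rewrite -(ler_nat R) !natrM.
have h2 : (t ^ 70 <= 2 * d)%N by apply: root70_le; apply: leq_trans t11.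
rewrite -(leq_pmul2r t0) -mulnA -expnSr.
apply: leq_trans h; rewrite (_ : 72 * d = 36 * (2 * d))%N; last by lia.
by rewrite leq_mul2l h2.
Qed.

(** As 72 = 3 * 24, the hypotheses make 24 r times the minimum less than 1. For a term attaining it
    this gives (24 r)^2 ln w <= ln d, 24 r w ln ln d < ln d, or 24 r log2 (c + 1) < ln d. In the
    second case also 2 (r + 1) <= ln d; in the third, ln 2 <= 3/4 turns 24 into 32. *)
Lemma vertex_ramsey_cases r : (r * n < 3 * d)%N ->
  [\/ (w ^ (576 * (r * r)) <= d)%N, ((2 * r.+1) ^ (24 * (r * w)) <= d)%N |
      ((c + 1) ^ (32 * r) <= d)%N].
Proof.
move=> rn; have l4 := vertex_ln_ge; have ll := vertex_lnln_ge.
have ld0 : 0 < ld by lra.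
have d0 : (0 < d)%N by apply: leq_trans vertex_deg_ge; rewrite expn_gt0.
have d0' : 0 < d%:R :> R by rewrite ltr0n.
have [r0|r0] := posnP r; first by apply: Or31; rewrite r0 expn0.
have r1 : 1 <= r%:R :> R by rewrite ler1n.
have w2 : 2 <= w%:R :> R by rewrite (ler_nat R 2).
have /andP[l2 l2'] := ln2_bounds.
have nge := n_ge; set mn := Num.min _ _ in nge.
have small : 24 * r%:R * mn < 1.
  rewrite -(ltr_pM2l d0') mulr1.
  have h1 : r%:R * (d%:R * (72 * mn)) <= r%:R * n%:R by apply: ler_wpM2l.
  have h2 : r%:R * n%:R < 3 * d%:R :> R by rewrite -!natrM ltr_nat.
  have h3 := le_lt_trans h1 h2.
  have aux (a b x : R) : a * (b * (72 * x)) < 3 * b -> b * (24 * a * x) < b by lra.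
  exact: aux.
have y0 : 0 < 24 * r%:R :> R by lra.
have : mn < 1 / (24 * r%:R) by rewrite ltr_pdivlMr // mulrC.
rewrite /mn !gt_min !ltr_pdivlMr // => /or3P[h|h|h].
- apply: Or31; apply: expn_le_of_ln => //; first exact: leq_trans w_ge.
  have a0 : 0 <= ln (w%:R : R) / ld by apply: divr_ge0; [apply: ln_ge0; lra | lra].
  set x := Num.sqrt _ in h.
  have x0 : 0 <= x by apply: sqrtr_ge0.
  have xE : x ^+ 2 = ln w%:R / ld by rewrite sqr_sqrtr.
  have : (x * (24 * r%:R)) ^+ 2 <= 1.
    by rewrite expr_le1 // ?mulr_ge0 // ltW.
  rewrite exprMn xE mulrAC (ler_pdivrMr _ _ ld0) mul1r => {}h.
  by apply: le_trans h; rewrite !natrM; lra.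
- apply: Or32; apply: expn_le_of_ln => //.
  have {}h : w%:R * ln ld * (24 * r%:R) < ld.
    by move: h; rewrite mulrAC (ltr_pdivrMr _ _ ld0) mul1r.
  have h24 : 24 * r%:R <= ld.
    by apply: le_trans (ltW h); rewrite ler_peMl ?ltW //; nra.
  have r2 : (2 * r.+1)%:R <= ld by rewrite natrM -natr1; lra.
  have lr : ln ((2 * r.+1)%:R : R) <= ln ld by rewrite ler_ln ?posrE ?ltr0n.
  have rw0 : 0 <= (24 * (r * w))%:R :> R by [].
  apply: le_trans (ler_wpM2l rw0 lr) _; rewrite !natrM; lra.
- apply: Or33; apply: expn_le_of_ln => //; first by rewrite addn1.
  have ln20 : 0 < ln (2 : R) by lra.
  rewrite natrM natrD; set y := ln (c%:R + 1).
  have y_ge0 : 0 <= y by apply: ln_ge0; rewrite lerDr.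
  have {}h : y * (24 * r%:R) < ld * ln 2.
    move: h; rewrite /log2 -/y mulrAC (ltr_pdivrMr _ _ ld0) mul1r.
    by rewrite mulrAC (ltr_pdivrMr _ _ ln20).
  nra.
Qed.
End Vertex.
End RealBounds.

(** * Transfer to correspondence-assignments *)

Lemma card_list_in_seq (C : choiceType) (s : seq C) (A : {fset C}) :
  {subset A <= s} -> (#|` A|%fset <= #|[set x : seq_sub s | val x \in A]|)%N.
Proof.
move=> As; pose q := pmap (insub : C -> option (seq_sub s)) (enum_fset A).
have qE : map val q = enum_fset A.
  rewrite pmap_filter; last exact: insubK.
  by apply/all_filterP/allP => x /As xs; rewrite insubT.
have uq : uniq q by rewrite -(map_inj_uniq val_inj) qE fset_uniq.
rewrite -[leqLHS]/(size (enum_fset A)) -qE size_map -(card_uniqP uq).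
apply/subset_leq_card/subsetP => x xq; rewrite inE.
by have := map_f val xq; rewrite qE.
Qed.

Lemma ln_sqr_unbounded (R : realType) (b : nat) : exists Delta0 : nat,
  forall Delta : nat, (Delta0 <= Delta)%N -> b%:R < ln (Delta%:R : R) ^+ 2 /\ (2 ^ 4 <= Delta)%N.
Proof.
exists (2 ^ (4 + 2 * b))%N => Delta h; split; last first.
  by apply: leq_trans h; rewrite leq_exp2l // leq_addr.
have := @ln_nat_ge R _ _ h; rewrite natrD natrM => l.
have b0 : 0 <= b%:R :> R by [].
rewrite expr2; nra.
Qed.

Section Transfer.
Variables (R : realType) (G : sgraph) (C : choiceType) (LM : corr_assignment G C).
Variable Delta : nat.
Hypothesis root_deg_ge : forall v : G, (2 ^ 11 <= root70 (deg v))%N.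
Hypothesis Delta_ge : (2 ^ 4 <= Delta)%N.
Hypothesis max_deg_le : (max_deg G <= Delta)%N.
Hypothesis lists : forall v : G,
   (deg v)%:R * local_ratio R v <= (#|` colors LM v|%fset)%:R :> R /\
   ln (Delta%:R : R) ^+ 2 <= (deg v)%:R.

Lemma deg_le_Delta (v : G) : (deg v <= Delta)%N.
Proof. by apply: leq_trans max_deg_le; apply: leq_bigmax. Qed.

Lemma exists_neighbour (v : G) : exists u, u \in nbhd v.
Proof.
apply/card_gt0P; rewrite -/(deg v) lt0n; apply: contraTneq (root_deg_ge v) => ->.
rewrite -ltnNge; apply: leq_ltn_trans (_ : 0 < _)%N; last by rewrite expn_gt0.
by apply: root70_min; rewrite exp0n.
Qed.

Lemma omega_ge2 (v : G) : (2 <= omega v)%N.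
Proof.
have [u uv] := exists_neighbour v; rewrite -(cards1 u); apply: clique_in_nbhd.
  by rewrite sub1set.
by apply/forall_inP => x /set1P->; apply/forall_inP => y /set1P->; rewrite eqxx.
Qed.

Lemma chi_ge1 (v : G) : (1 <= chi v)%N.
Proof.
have [u uv] := exists_neighbour v; have [col [col_lt _]] := nbhd_coloring v.
exact: leq_ltn_trans (col_lt u uv).
Qed.

(** Since ln^2 Delta <= deg v <= t^70, log Delta is at most of order t^35; this keeps m small
    against the lists. *)
Lemma log_Delta_le (v : G) : ((trunc_log 2 Delta).+1 <= 3 * root70 (deg v) ^ 35)%N.
Proof.
have Delta0 : (0 < Delta)%N by apply: leq_trans Delta_ge.
set B := trunc_log 2 Delta; set t := root70 (deg v).
have t0 : (0 < t ^ 35)%N.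
  by rewrite expn_gt0; apply/orP; left; apply: leq_trans (root_deg_ge v); rewrite expn_gt0.
have h1 : B%:R / 2 <= ln (Delta%:R : R) by apply: ln_nat_ge; rewrite trunc_logP.
have [_ h2] := lists v.
have h3 : (B * B <= 4 * deg v)%N.
  rewrite -(ler_nat R) !natrM; have B0 : 0 <= B%:R :> R by [].
  move: h1 h2; rewrite expr2; nra.
have h4 : (B <= 2 * t ^ 35)%N.
  rewrite -leq_sqr expnMn -expnM; apply: leq_trans h3 _.
  by rewrite (_ : 2 ^ 2 = 4)%N // leq_mul2l root70_ge.
by rewrite -add1n -[3%N]/(1 + 2)%N mulnDl mul1n leq_add.
Qed.

Let n (v : G) : nat := #|` colors LM v|%fset.
(** Lists are cut down to 3 deg v colors, because the bound on addable pairs grows with |L v|. *)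
Let k (v : G) : nat := minn (n v) (3 * deg v).
(** r + 1 is 3 deg v / k v rounded up. Subtracting 1 first keeps r k v < 3 deg v strict, so r = 0
    for a list of 3 deg v colors. *)
Let r (v : G) : nat := ((3 * deg v).-1 %/ k v)%N.

Lemma trunc_list_ge (v : G) : (28 * root70 (deg v) ^ 69 <= k v)%N.
Proof.
have [h _] := lists v.
have h1 := vertex_list_ge (root_deg_ge v) (omega_ge2 v) (chi_ge1 v) h.
rewrite leq_min; apply/andP; split.
  by apply: leq_trans h1; rewrite leq_mul2r orbT.
have t11 := root_deg_ge v; set t := root70 (deg v) in t11 *.
have h2 : (t ^ 70 <= 2 * deg v)%N by apply: root70_le; apply: leq_trans t11.
have h3 : (56 * t ^ 69 <= t ^ 70)%N.
  by rewrite [leqRHS]expnS leq_mul2r; apply/orP; right; apply: leq_trans t11.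
move: h2 h3; move: (t ^ 69)%N (t ^ 70)%N => x y; lia.
Qed.

Lemma trunc_list_gt0 (v : G) : (0 < k v)%N.
Proof.
have t0 : (0 < root70 (deg v))%N := leq_trans (isT : 0 < 2 ^ 11)%N (root_deg_ge v).
have x0 : (0 < 28 * root70 (deg v) ^ 69)%N by rewrite muln_gt0 expn_gt0 t0.
exact: leq_trans x0 (trunc_list_ge v).
Qed.

Lemma trunc_ratio_ge (v : G) : (3 * deg v <= k v * (r v).+1)%N.
Proof.
have [u uv] := exists_neighbour v.
have d0 : (0 < deg v)%N by apply/card_gt0P; exists u.
have := ltn_ceil (3 * deg v).-1 (trunc_list_gt0 v).
by rewrite -/(r v) prednK ?muln_gt0 // [X in (_ <= X)%N]mulnC.
Qed.

Lemma trunc_ratio_cases (v : G) :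
  [\/ (omega v ^ (576 * (r v * r v)) <= deg v)%N,
      ((2 * (r v).+1) ^ (24 * (r v * omega v)) <= deg v)%N |
      ((chi v + 1) ^ (32 * r v) <= deg v)%N].
Proof.
have [u uv] := exists_neighbour v.
have d0 : (0 < deg v)%N by apply/card_gt0P; exists u.
have [h _] := lists v.
have [nd|dn] := leqP (n v) (3 * deg v); last first.
  apply: Or31; rewrite /r /k (minn_idPr (ltnW dn)) divn_small ?expn0 //.
  by rewrite prednK ?muln_gt0.
apply: (vertex_ramsey_cases (root_deg_ge v) (omega_ge2 v) h).
rewrite -/(n v) /r /k (minn_idPl nd); apply: leq_ltn_trans (leq_trunc_div _ _) _.
by rewrite prednK ?muln_gt0.
Qed.

(** Only finitely many colors occur in the lists; the finite type of these replaces C. The conflict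
    relation includes the edge, as [corr] is constrained on edges only. *)
Lemma corr_colorable_of_lists : corr_colorable LM.
Proof.
pose s := flatten [seq enum_fset (colors LM u) | u <- enum G].
have ss u : {subset colors LM u <= s}.
  by move=> x xu; apply/flatten_mapP; exists u; rewrite // mem_enum.
have H u : exists L : {set seq_sub s},
    L \subset [set x : seq_sub s | val x \in colors LM u] /\ #|L| = k u.
  have [|L LA cL] := @subset_of_card _ [set x : seq_sub s | val x \in colors LM u] (k u).
    by apply: leq_trans (card_list_in_seq (@ss u)); apply: geq_minl.
  by exists L.
have [L LP] := fin_all_exists H.
pose cf u (a : seq_sub s) v (b : seq_sub s) := edge u v && corr LM u v (val a) (val b).
have cf_edge u a v b : cf u a v b -> edge u v by case/andP.
have cf_sym u a v b : cf u a v b = cf v b u a.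
  by rewrite /cf [edge v u]edge_sym; apply: andb_id2l => uv; apply: corr_sym.
have cf_inj u a v b b' : cf u a v b -> cf u a v b' -> b = b'.
  by move=> /andP[uv h] /andP[_ h']; apply/val_inj/(corr_matching uv h h').
have [phi phiP] : exists phi : G -> seq_sub s, forall u,
    phi u \in L u /\ forall v, ~~ cf u (phi u) v (phi v).
  apply: (@coloring_from_parameters G _ L cf cf_edge cf_sym cf_inj Delta
    (trunc_log 2 Delta).+1 r).
  - exact: deg_le_Delta.
  - by rewrite trunc_log_ltn.
  - by rewrite ltnW // ltnS; apply: trunc_log_max.
  - exact: log_Delta_le.
  - exact: root_deg_ge.
  - by move=> v; have [_ ->] := LP v; apply: geq_minr.
  - by move=> v; have [_ ->] := LP v; apply: trunc_list_ge.
  - by move=> v; have [_ ->] := LP v; apply: trunc_ratio_ge.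
  - exact: trunc_ratio_cases.
exists (fun u => val (phi u)); split=> [u|u v uv].
  by have [pu _] := phiP u; have [/subsetP/(_ _ pu)] := LP u; rewrite inE.
by have [_ /(_ v)] := phiP u; rewrite /cf uv.
Qed.
End Transfer.

Theorem theorem1p7 (R : realType) :
  exists Delta0 : nat, forall Delta : nat, (Delta0 <= Delta)%N ->
  forall (G : sgraph) (C : choiceType) (LM : corr_assignment G C),
    (max_deg G <= Delta)%N ->
    (forall v : G,
       (deg v)%:R * local_ratio R v <= (#|` colors LM v|%fset)%:R :> R /\
       ln (Delta%:R : R) ^+ 2 <= (deg v)%:R) ->
    corr_colorable LM.
Proof.
(* deg v >= ln^2 Delta > (2^11)^70 puts [root70 (deg v)] above 2^11. *)
have [Delta0 large] := ln_sqr_unbounded R ((2 ^ 11) ^ 70).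
exists Delta0 => Delta /large[l1 l2] G C LM maxD lists.
apply: (corr_colorable_of_lists _ l2 maxD lists) => v; apply/ltnW/root70_gt.
by have [_ h] := lists v; have := lt_le_trans l1 h; rewrite ltr_nat.
Qed.
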